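(* Let $0<\rho_l<\rho_u<\infty$, $c>0$ and $\alpha\ge 0$ be constants. Let $k,L\to\infty$ in parallel while $\rho_l<\log L/\log k<\rho_u$, and let $(A_k)$ be a sequence of $k\times k$ matrices with $A_k\in\mathcal{A}_{c,\alpha}$. Then for any constant $\gamma>7+\alpha$, asymptotically almost surely the spectral gap of the random transition probability matrix $G_L(A_k)$ satisfies $$\lambda(G_L(A_k))\ \ge\ \frac{1}{L\log^\gamma k}.$$
   Context: Notation: $\log^\gamma k=(\log k)^\gamma$. ''Asymptotically almost surely'' means with probability tending to $1$ in the stated limit. Spectral gap: for an irreducible doubly stochastic matrix $A$, $\lambda(A)=\min\{1-|\mu| : \mu\ne 1 \text{ is an eigenvalue of } A\}$. Class $\mathcal{A}_{c,\alpha}$ ($c>0$, $\alpha\ge0$ constants independent of the matrix and of $k$): the set of symmetric doubly stochastic (irreducible, so that $\lambda$ is defined) matrices $A$ with $\lambda(A)\ge \Delta_k:=c\log^{-\alpha}k$, where $k$ is the dimension of $A$. Reconnected arcs model $G_L(A)$: let $A\in\mathbb{R}^{k\times k}$ be symmetric doubly stochastic and $L$ a real number ($L\geq 1$). Choose $k$ independent random values $L_1,\dots,L_k$ from the geometric distribution $Geo(1/L)$ on $\{1,2,\dots\}$ (success probability $1/L$, mean $L$). For each $i=1,\dots,k$ build a directed arc of $L_i$ nodes $(i,1),\dots,(i,L_i)$, with an edge of weight $1$ from $(i,\ell)$ to $(i,\ell+1)$ for $\ell<L_i$. For all $i,j\in\{1,\dots,k\}$ add a directed edge from $(j,L_j)$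 to $(i+1,1)$ with weight $A_{ij}=A_{ji}$ (indices of arcs are cyclic, $k+1\equiv1$; no edge if $A_{ij}=0$). $G_L(A)$ is the random Markov transition matrix (of size $\sum_i L_i$) of this weighted directed graph; it is doubly stochastic. *)

(* Defs.v *)
From mathcomp Require Import all_boot all_order all_algebra.
From mathcomp Require Import complex.
From mathcomp Require Import all_classical all_reals all_analysis.

Set Implicit Arguments.
Unset Strict Implicit.
Unset Printing Implicit Defensive.

Import Order.TTheory GRing.Theory Num.Theory.
Import numFieldNormedType.Exports.

Local Open Scope classical_set_scope.
Local Open Scope ring_scope.

Section matrices.
Context {R : realType} {n : nat}.
Implicit Type A : 'M[R]_n.

Definition doubly_stochastic A : Prop :=
  [/\ forall i j, 0 <= A i j,
      forall i, \sum_j A i j = 1 &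
      forall j, \sum_i A i j = 1].

Definition irreducible_mx A : Prop :=
  forall i j, connect [rel x y | A x y != 0] i j.

(* The eigenvalues are the complex ones: a nonsymmetric real matrix may have
   non-real eigenvalues.  [`|mu|] has type [R[i]], with zero imaginary part.
   The set below is finite, so that its infimum is a minimum as soon as it is
   nonempty; for an irreducible doubly stochastic matrix it is empty only in
   dimension 1, where [inf set0 = 0]. *)
Definition spectral_gap A : R :=
  inf [set 1 - complex.Re `|mu| | mu in
        [set mu : R[i] | eigenvalue (map_mx (real_complex R) A) mu
                         /\ mu <> 1]].

Definition gap_class (c alpha : R) A : Prop :=
  [/\ A^T = A, doubly_stochastic A, irreducible_mx A &
      c * ln n%:R `^ (- alpha) <= spectral_gap A].

End matrices.

Section reconnected_arcs.
Context {R : realType} {k : nat}.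
Implicit Types (A : 'M[R]_k) (l : 'I_k -> nat).

(* Arcs and positions inside an arc are numbered from 0: the node (i, m) of the
   sigma type is the (m+1)-st node of the arc i, and the last one of the arc
   when m + 1 = l i.  The last node of the arc j is joined to the first node of
   the arc i + 1 with weight A i j; hence the [ord_pred], which is cyclic. *)
Definition arcs_weight A l (x y : {i : 'I_k & 'I_(l i)}) : R :=
  if (tagged x).+1 == l (tag x)
  then if tagged y == 0%N :> nat then A (ord_pred (tag y)) (tag x) else 0
  else ((tag y == tag x) && (tagged y == (tagged x).+1 :> nat))%:R.

(* [tagnat.sig] is the bijection from ['I_(\sum_i l i)] to the set of nodes. *)
Definition reconnected_arcs A l : 'M[R]_(\sum_i l i)%N :=
  \matrix_(a, b) arcs_weight A (tagnat.sig a) (tagnat.sig b).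

End reconnected_arcs.

Section random_variables.
Context d (T : measurableType d) (R : realType) (P : probability T R).

(* Geometric law on {1, 2, ...} with success probability [p]. *)
Definition geometric_rv (p : R) (X : {RV P >-> nat}) : Prop :=
  forall m : nat, distribution P X [set m] =
    (if m is m'.+1 then p * (1 - p) ^+ m' else 0)%:E.

Definition independent_rvs d' (T' : measurableType d') (I : finType)
    (X : I -> {RV P >-> T'}) : Prop :=
  forall (J : {set I}) (B : I -> set T'), (forall i, measurable (B i)) ->
    P (\bigcap_(i in [set` J]) X i @^-1` B i) =
    (\prod_(i in J) P (X i @^-1` B i))%E.

End random_variables.

(* Main.v *)
Require Import Defs.
From mathcomp Require Import all_boot all_order all_algebra.
From mathcomp Require Import complex ring lra.
From mathcomp Require Import all_classical all_reals all_analysis.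

(** Write G for the transition matrix, A for the symmetric matrix, and let v be a
    row eigenvector of G with eigenvalue mu and zero sum.  Inside an arc v is
    geometric with ratio mu, hence determined by its value x_i at the last node
    of the arc i.  The edges between arcs and the zero sum then become
      (x A)_(i-1) = mu^(l_i) x_i   and   sum_i x_i h_i = 0,
    where h_i = 1 + mu + ... + mu^(l_i - 1): the random graph enters only through
    the numbers mu^(l_i) ([arcs_eigenvector]).

    Suppose |mu| > 1 - delta, with delta much smaller than the inverse of the
    longest arc.  Then every |mu^(l_i)| is close to 1, so A hardly decreases the
    norm of x, and the spectral gap of A forces x to be close in quadratic mean to
    a constant a <> 0 ([fluctuation_le]).  Replacing x by a in the two equations
    gives two approximate identities:
    - mu^(l_i) is close to 1 for most i ([mean_dispersion_le]);
    - a * sum_i h_i is small ([mean_mass_le]).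
    If mu is very close to 1 on the scale of the inverse of the longest arc, then
    h_i is close to l_i and the second one fails, because the arcs have a
    substantial total length.  Otherwise the first one fails for typical lengths,
    because the geometric law does not concentrate on
    Z = {n | mu^n is close to 1}: for some d <= L / 2 the power mu^d is far from 1,
    so that Z + d is disjoint from Z, whereas translation by d multiplies
    probabilities by (1 - 1/L)^d >= 1/2 ([far_from_one_power],
    [geometric_escape]).  Hence the complement of Z has probability at least 1/3.

    This has to hold for all mu simultaneously.  The unit disk is replaced by a
    grid with polynomially many points in k, and the k arcs are cut into
    consecutive blocks of order log k arcs.  All arcs of a block land in Z with
    probability at most (2/3)^(C log k), which beats the number of grid points and
    of blocks; so with high probability every block contains an arc with mu^(l_i)
    far from 1, for every mu of the grid ([good_lengths_prob]).  The logarithms that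
    are lost come from the longest arc, of order L log k, from the size of the
    blocks and from the gap of A.  A contradiction is reached as soon as
    (log k)^gamma exceeds a large constant times (log k)^(5 + alpha)
    ([scale_conditions]). *)

Set Implicit Arguments.
Unset Strict Implicit.
Unset Printing Implicit Defensive.

Import Order.TTheory GRing.Theory Num.Theory.
Import numFieldNormedType.Exports.

Local Open Scope classical_set_scope.
Local Open Scope ring_scope.

(** * Real-valued modulus of complex numbers *)

Section Modulus.
Context {R : realType}.
Implicit Types z w : R[i].

(** The norm of [R[i]] takes its values in [R[i]]; a modulus in [R] gives access to
    linear arithmetic, and it is the quantity that [spectral_gap] uses. *)
Definition cmod z : R := complex.Re `|z|.

Lemma cmodE z : `|z| = (cmod z)%:C%C.
Proof. by rewrite RRe_real ?normr_real. Qed.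

Lemma cmod_ge0 z : 0 <= cmod z.
Proof. by rewrite -ler0c -cmodE normr_ge0. Qed.

Lemma cmodM z w : cmod (z * w) = cmod z * cmod w.
Proof. by apply: complexI; rewrite rmorphM /= -!cmodE normrM. Qed.

Lemma cmodX z n : cmod (z ^+ n) = cmod z ^+ n.
Proof. by apply: complexI; rewrite rmorphXn /= -!cmodE normrX. Qed.

Lemma cmodD z w : cmod (z + w) <= cmod z + cmod w.
Proof. by rewrite -lecR rmorphD /= -!cmodE ler_normD. Qed.

Lemma cmodN z : cmod (- z) = cmod z.
Proof. by rewrite /cmod normrN. Qed.

Lemma cmodBC z w : cmod (z - w) = cmod (w - z).
Proof. by rewrite -cmodN opprB. Qed.

Lemma cmodB z w : cmod (z - w) <= cmod z + cmod w.
Proof. by rewrite -[cmod w]cmodN cmodD. Qed.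

Lemma cmod_eq0 z : (cmod z == 0) = (z == 0).
Proof. by rewrite -(inj_eq (@complexI R)) -cmodE normr_eq0. Qed.

Lemma cmod_real (x : R) : cmod x%:C%C = `|x|.
Proof. by rewrite /cmod normc_def /= expr0n addr0 sqrtr_sqr. Qed.

Lemma cmod0 : cmod 0 = 0.
Proof. by apply/eqP; rewrite cmod_eq0. Qed.

Lemma cmod1 : cmod 1 = 1.
Proof. by rewrite (cmod_real 1) normr1. Qed.

Lemma cmod_nat n : cmod n%:R = n%:R.
Proof. by rewrite -[n%:R](rmorph_nat (real_complex R)) cmod_real ger0_norm. Qed.

Lemma cmod_sum (I : Type) (r : seq I) (p : pred I) (F : I -> R[i]) :
  cmod (\sum_(i <- r | p i) F i) <= \sum_(i <- r | p i) cmod (F i).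
Proof.
elim/big_ind2: _ => [|x a y b ha hb|//]; first by rewrite cmod0.
exact: le_trans (cmodD _ _) (lerD ha hb).
Qed.

Lemma sqr_cmod z : (cmod z ^+ 2)%:C%C = z * z^*.
Proof. by rewrite rmorphXn /= -cmodE normCK. Qed.

Lemma sqr_cmodE z : cmod z ^+ 2 = complex.Re z ^+ 2 + complex.Im z ^+ 2.
Proof. by apply: complexI; rewrite add_Re2_Im2 rmorphXn /= -cmodE. Qed.

End Modulus.

(** * Symmetric doubly stochastic matrices *)

Section Energy.
Context {R : realType} {n : nat}.
Implicit Types (v : 'rV[R[i]]_n) (A : 'M[R]_n).

Definition sqnorm v : R := \sum_i cmod (v 0 i) ^+ 2.

Definition cmx A : 'M[R[i]]_n := map_mx (real_complex R) A.

Lemma sqnorm_ge0 v : 0 <= sqnorm v.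
Proof. by apply: sumr_ge0 => i _; rewrite sqr_ge0. Qed.

Lemma sqnorm_gt0 v : v != 0 -> 0 < sqnorm v.
Proof.
move=> v0; rewrite lt_neqAle sqnorm_ge0 andbT eq_sym.
apply: contra v0; rewrite psumr_eq0 => [/allP h|i _]; last exact: sqr_ge0.
apply/eqP/rowP => i; apply/eqP; rewrite mxE -cmod_eq0.
by have := h i; rewrite mem_index_enum sqrf_eq0 => /(_ isT).
Qed.

Lemma sqnormE v : (sqnorm v)%:C%C = (v *m (map_mx Num.conj v^T)) 0 0.
Proof.
rewrite mxE rmorph_sum; apply: eq_bigr => i _.
by rewrite /= sqr_cmod !mxE.
Qed.

Lemma sqnorm_unitary (U : 'M[R[i]]_n) v :
  U *m (map_mx Num.conj U^T) = 1%:M -> sqnorm (v *m U) = sqnorm v.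
Proof.
move=> hU; apply: complexI; rewrite !sqnormE trmx_mul map_mxM mulmxA.
by rewrite -(mulmxA v) hU mulmx1.
Qed.

Lemma sqr_wmean_le (I : finType) (p u : I -> R) :
  (forall i, 0 <= p i) -> \sum_i p i = 1 ->
  (\sum_i p i * u i) ^+ 2 <= \sum_i p i * u i ^+ 2.
Proof.
move=> p0 p1; have [m mE] : exists m, m = \sum_i p i * u i by eexists.
rewrite -mE.
have: 0 <= \sum_i p i * (u i - m) ^+ 2.
  by apply: sumr_ge0 => i _; rewrite mulr_ge0 ?sqr_ge0.
have -> : \sum_i p i * (u i - m) ^+ 2 = \sum_i p i * u i ^+ 2
    - 2 * m * (\sum_i p i * u i) + m ^+ 2 * \sum_i p i.
  rewrite !mulr_sumr -sumrN -!big_split /=.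
  by apply: eq_bigr => i _; ring.
rewrite p1 -mE; lra.
Qed.

(** Jensen along each column, then the row sums. *)
Lemma sqnorm_doubly_stochastic A v :
  doubly_stochastic A -> sqnorm (v *m cmx A) <= sqnorm v.
Proof.
case=> A0 Ar Ac.
apply: (@le_trans _ _ (\sum_j \sum_i A i j * cmod (v 0 i) ^+ 2)).
  apply: ler_sum => j _; apply: le_trans (sqr_wmean_le _ _ (Ac j)) => //.
  rewrite ler_sqr ?nnegrE ?cmod_ge0 //; last first.
    by apply: sumr_ge0 => i _; rewrite mulr_ge0 ?cmod_ge0.
  rewrite mxE; apply: le_trans (cmod_sum _ _ _) _; apply: ler_sum => i _.
  by rewrite mxE cmodM cmod_real ger0_norm // mulrC.
rewrite exchange_big /=; apply: ler_sum => i _.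
by rewrite -mulr_suml Ar mul1r.
Qed.

Lemma sqnormZ (a : R[i]) v : sqnorm (a *: v) = cmod a ^+ 2 * sqnorm v.
Proof.
by rewrite mulr_sumr; apply: eq_bigr => i _; rewrite mxE cmodM exprMn.
Qed.

Lemma eigenvalue_doubly_stochastic A mu :
  doubly_stochastic A -> eigenvalue (cmx A) mu -> cmod mu <= 1.
Proof.
move=> dsA /eigenvalueP[v vA v0].
have := sqnorm_doubly_stochastic v dsA.
rewrite vA sqnormZ ger_pMl ?sqnorm_gt0 //.
by rewrite expr_le1 ?cmod_ge0.
Qed.

Lemma spectral_gap_le A mu : doubly_stochastic A ->
  eigenvalue (cmx A) mu -> mu != 1 -> spectral_gap A <= 1 - cmod mu.
Proof.
move=> dsA emu mu1; apply: ge_inf; last first.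
  by exists mu => //; split => //; apply/eqP.
exists 0 => _ [nu [enu _] <-].
by rewrite subr_ge0 (eigenvalue_doubly_stochastic dsA).
Qed.

(** The Dirichlet form sum_ij A_ij (u_i - u_j)^2 of a stationary u vanishes, so u
    does not vary along the edges of the connected graph of A. *)
Lemma stationary_real_const A (u : 'I_n -> R) :
  doubly_stochastic A -> irreducible_mx A ->
  (forall j, \sum_i u i * A i j = u j) -> forall i j, u i = u j.
Proof.
case=> A0 Ar Ac irrA uA.
have S0 : \sum_i \sum_j A i j * (u i - u j) ^+ 2 = 0.
  have -> : \sum_i \sum_j A i j * (u i - u j) ^+ 2 =
      \sum_i \sum_j A i j * u i ^+ 2 + \sum_i \sum_j A i j * u j ^+ 2
      - 2 * \sum_i \sum_j u i * A i j * u j.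
    rewrite mulr_sumr -sumrN -!big_split /=; apply: eq_bigr => i _.
    rewrite mulr_sumr -sumrN -!big_split /=; apply: eq_bigr => j _; ring.
  rewrite [X in _ + X - _]exchange_big /= [X in _ - 2 * X]exchange_big /=.
  have -> : \sum_i \sum_j A i j * u i ^+ 2 = \sum_i u i ^+ 2.
    by apply: eq_bigr => i _; rewrite -mulr_suml Ar mul1r.
  have -> : \sum_j \sum_i A i j * u j ^+ 2 = \sum_i u i ^+ 2.
    by apply: eq_bigr => i _; rewrite -mulr_suml Ac mul1r.
  have -> : \sum_j \sum_i u i * A i j * u j = \sum_i u i ^+ 2.
    by apply: eq_bigr => i _; rewrite -mulr_suml uA.
  ring.
have step i j : A i j != 0 -> u i = u j.
  move=> Aij; apply/eqP; rewrite -subr_eq0 -sqrf_eq0.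
  have F0 a b : 0 <= A a b * (u a - u b) ^+ 2 by rewrite mulr_ge0 ?sqr_ge0.
  move/eqP: S0; rewrite psumr_eq0 => [|a _]; last exact: sumr_ge0.
  move=> /allP/(_ i); rewrite mem_index_enum => /(_ isT) /=.
  rewrite psumr_eq0 // => /allP/(_ j); rewrite mem_index_enum => /(_ isT) /=.
  by rewrite mulf_eq0 (negbTE Aij).
move=> i j; have /connectP[p] := irrA i j.
elim: p i => [|a p IH] i /=; first by move=> _ ->.
by case/andP => /step -> pth jE; apply: IH.
Qed.

Lemma stationary_const A v :
  doubly_stochastic A -> irreducible_mx A -> v *m cmx A = v ->
  forall i j, v 0 i = v 0 j.
Proof.
move=> dsA irrA vA i j; apply/eqP; rewrite eq_complex.
have key j' : \sum_i v 0 i * (A i j')%:C%C = v 0 j'.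
  by rewrite -{2}vA mxE; apply: eq_bigr => i' _; rewrite mxE.
rewrite (@stationary_real_const A (fun i => complex.Re (v 0 i)) dsA irrA _ i j).
  rewrite (@stationary_real_const A (fun i => complex.Im (v 0 i)) dsA irrA _ i j).
    by rewrite !eqxx.
  move=> j'; rewrite -[in RHS]key raddf_sum; apply: eq_bigr => i' _.
  by case: (v 0 i') => a b /=; ring.
move=> j'; rewrite -[in RHS]key raddf_sum; apply: eq_bigr => i' _.
by case: (v 0 i') => a b /=; ring.
Qed.

(** In an orthonormal basis of eigenvectors, those with eigenvalue 1 are constant,
    hence orthogonal to v; on the others |d_i|^2 <= |d_i| <= 1 - D. *)
Lemma sqnorm_gap A v (D : R) :
  A^T = A -> doubly_stochastic A -> irreducible_mx A -> D <= spectral_gap A ->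
  \sum_i v 0 i = 0 -> sqnorm (v *m cmx A) <= (1 - D) * sqnorm v.
Proof.
move=> symA dsA irrA gapA v0.
have nA : cmx A \is normalmx.
  apply/normalmxP; suff -> : (map_mx Num.conj (cmx A)^T) = cmx A by [].
  apply/matrixP => i j; rewrite !mxE -{2}symA mxE.
  by apply/CrealP; apply/complex_realP; exists (A j i).
have /= := @orthomx_spectralP _ _ _ nA.
have := spectral_unitarymx (cmx A).
move: (spectralmx _) (spectral_diag _) => U d Uu.
rewrite invmx_unitary // => AE.
have UU : U *m (map_mx Num.conj U^T) = 1%:M by apply/unitarymxP.
have UU' : (map_mx Num.conj U^T) *m U = 1%:M by apply: mulmx1C.
have rowU i : row i U *m cmx A = d 0 i *: row i U.
  rewrite AE !mulmxA -row_mul.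
  rewrite UU -row_mul mul1mx -row_mul; apply/rowP => j.
  by rewrite mxE mul_diag_mx !mxE.
have rowU0 i : row i U != 0.
  apply/eqP => r0; have /matrixP/(_ i i) := UU.
  rewrite !mxE big1 ?eqxx => [/esym/eqP|j _]; first by rewrite oner_eq0.
  by have /rowP/(_ j) := r0; rewrite !mxE => ->; rewrite mul0r.
pose u := v *m (map_mx Num.conj U^T).
have vE : v = u *m U by rewrite -mulmxA UU' mulmx1.
rewrite {1}AE !mulmxA (sqnorm_unitary _ UU) -/u [in X in _ <= X]vE (sqnorm_unitary _ UU).
rewrite /sqnorm mulr_sumr; apply: ler_sum => i _.
rewrite mul_mx_diag mxE cmodM exprMn mulrC.
have [d1|d1] := eqVneq (d 0 i) 1.
  suff -> : u 0 i = 0 by rewrite cmod0 expr0n !mulr0.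
  have cst := @stationary_const A (row i U) dsA irrA.
  rewrite rowU d1 scale1r in cst; have {}cst := cst erefl.
  rewrite mxE (eq_bigr (fun j => v 0 j * (U i i)^*)) => [|j _].
    by rewrite -mulr_suml v0 mul0r.
  by have := cst j i; rewrite !mxE => ->.
have ed : eigenvalue (cmx A) (d 0 i) by apply/eigenvalueP; exists (row i U).
apply: ler_wpM2r; first exact: sqr_ge0.
have := spectral_gap_le dsA ed d1.
have := eigenvalue_doubly_stochastic dsA ed; have := cmod_ge0 (d 0 i).
by move: (cmod _) => x x0 x1 hx; nra.
Qed.

End Energy.

(** * Elementary estimates *)

Section NearOne.
Context {R : realType}.
Implicit Types (w : R[i]) (r : R).

Lemma exprn_ge_bernoulli r n : 0 <= r <= 1 -> 1 - n%:R * (1 - r) <= r ^+ n.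
Proof.
case/andP=> r0 r1; elim: n => [|n IH]; first by rewrite mul0r subr0 expr0.
have n0 : 0 <= (n%:R : R) by [].
rewrite exprS -natr1; move: IH n0; move: (r ^+ n) (n%:R) => y m IH m0.
have : r * (1 - m * (1 - r)) <= r * y by rewrite ler_wpM2l.
have : 0 <= m * (1 - r) ^+ 2 by rewrite mulr_ge0 ?sqr_ge0.
nra.
Qed.

Lemma cmod_1subX w n : cmod w <= 1 -> cmod (1 - w ^+ n) <= n%:R * cmod (1 - w).
Proof.
move=> w1; elim: n => [|n IH]; first by rewrite expr0 subrr cmod0 mul0r.
have -> : 1 - w ^+ n.+1 = (1 - w) + w * (1 - w ^+ n) by rewrite exprS; ring.
rewrite -natr1 mulrDl mul1r [leRHS]addrC; apply: le_trans (cmodD _ _) _.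
rewrite lerD2l cmodM; apply: le_trans IH.
by rewrite ler_piMl ?cmod_ge0.
Qed.

Lemma sqr_cmodD_le (u w : R[i]) :
  cmod (u + w) ^+ 2 <= 2 * (cmod u ^+ 2 + cmod w ^+ 2).
Proof.
have := cmodD u w; have := cmod_ge0 (u + w).
move: (cmod _) (cmod u) (cmod w) => a b c a0 abc.
have : a ^+ 2 <= (b + c) ^+ 2 by rewrite ler_sqr ?nnegrE // (le_trans a0).
by have := sqr_ge0 (b - c); nra.
Qed.

Lemma sqr_sum_le (I : finType) (u : I -> R) :
  (\sum_i u i) ^+ 2 <= #|I|%:R * \sum_i u i ^+ 2.
Proof.
have [I0|I0] := posnP #|I|.
  have e (F : I -> R) : \sum_i F i = 0.
    by apply: big1 => i; have := max_card (pred1 i); rewrite card1 I0.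
  by rewrite !e expr0n mulr0.
have c0 : 0 < (#|I|%:R : R) by rewrite ltr0n.
have h1 : \sum_(i : I) #|I|%:R^-1 = 1 :> R.
  by rewrite sumr_const cardT -cardE -[_^-1 *+ _]mulr_natr mulVf ?gt_eqF.
have /= := @sqr_wmean_le _ I (fun=> #|I|%:R^-1) u _ h1.
rewrite -!mulr_sumr exprMn => h.
have {}h := h (fun=> ltW (etrans (invr_gt0 _) c0)).
rewrite -(@ler_pM2l _ (#|I|%:R^-1 ^+ 2)) ?exprn_gt0 ?invr_gt0 //.
apply: le_trans h _; rewrite expr2 mulrA -(mulrA _ _ (#|I|%:R)).
by rewrite mulVf ?gt_eqF // mulr1.
Qed.

(** Pythagoras: a vector of zero sum is orthogonal to the constants. *)
Lemma sqnormD_mean0 n (a : R[i]) (w : 'rV[R[i]]_n) : \sum_i w 0 i = 0 ->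
  sqnorm (const_mx a + w) = n%:R * cmod a ^+ 2 + sqnorm w.
Proof.
move=> w0.
have rw0 : \sum_i complex.Re (w 0 i) = 0 by rewrite -raddf_sum w0.
have iw0 : \sum_i complex.Im (w 0 i) = 0 by rewrite -raddf_sum w0.
have -> : sqnorm (const_mx a + w) = \sum_(i < n) cmod a ^+ 2 + sqnorm w
   + 2 * complex.Re a * (\sum_i complex.Re (w 0 i))
   + 2 * complex.Im a * (\sum_i complex.Im (w 0 i)).
  rewrite !mulr_sumr -!big_split /=; apply: eq_bigr => i _.
  rewrite !mxE !sqr_cmodE; move: (w 0 i) => z; case: a => a b; case: z => c e /=; ring.
by rewrite rw0 iw0 !mulr0 !addr0 sumr_const card_ord -[_ *+ n]mulr_natl.
Qed.

End NearOne.

(** * Eigenvectors of the reconnected arcs *)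

Section ArcNodes.
Context {R : realType} {k : nat}.
Implicit Types (A : 'M[R]_k) (l : 'I_k -> nat).

Lemma sum_nodes (V : nmodType) l (F : 'I_(\sum_i l i)%N -> V) :
  \sum_a F a = \sum_i \sum_(m < l i) F (tagnat.Rank i m).
Proof.
rewrite (reindex _ (@tagnat.rank_bij_on _ l)) /=.
rewrite (sig_big_dep xpredT (fun=> xpredT)
  (fun i (m : 'I_(l i)) => F (tagnat.Rank i m))) /=.
by apply: eq_bigr => -[i m] _.
Qed.

Lemma sum_single_node (V : nmodType) l (F : forall i, 'I_(l i) -> V) i m :
  (forall j p, j != i -> F j p = 0) -> (forall p, p != m -> F i p = 0) ->
  \sum_j \sum_p F j p = F i m.
Proof.
move=> Fj Fp; rewrite (bigD1 i) //= (bigD1 m) //= !big1 ?addr0 //.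
by move=> j ji; rewrite big1 // => p _; exact: Fj.
Qed.

Lemma reconnected_arcsE A l i (m : 'I_(l i)) j (p : 'I_(l j)) :
  reconnected_arcs A l (tagnat.Rank i m) (tagnat.Rank j p) =
  if m.+1 == l i then if p == 0%N :> nat then A (ord_pred j) i else 0
  else ((j == i) && (p == m.+1 :> nat))%:R.
Proof. by rewrite mxE /arcs_weight /tagnat.Rank !tagnat.rankK. Qed.

Lemma reconnected_arcs_row_sum A l : (forall i, (0 < l i)%N) ->
  doubly_stochastic A -> forall a, \sum_b reconnected_arcs A l a b = 1.
Proof.
move=> l0 [A0 Ar Ac] a; rewrite -[a]tagnat.sig2K.
move: (tagnat.sig1 a) (tagnat.sig2 a) => i m; rewrite sum_nodes.
have [ml|ml] := eqVneq m.+1 (l i).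
  rewrite -[RHS](Ac i) [RHS](reindex_inj (@ord_pred_inj k)) /=.
  apply: eq_bigr => j _; rewrite (bigD1 (Ordinal (l0 j))) //=.
  rewrite reconnected_arcsE ml !eqxx big1 ?addr0 // => p p0.
  rewrite reconnected_arcsE ml eqxx; case: eqP => // pz; case/eqP: p0.
  exact: val_inj.
have ml' : (m.+1 < l i)%N by rewrite ltn_neqAle ml ltn_ord.
rewrite (@sum_single_node _ l _ i (Ordinal ml')).
- by rewrite reconnected_arcsE (negbTE ml) !eqxx.
- by move=> j p ji; rewrite reconnected_arcsE (negbTE ml) (negbTE ji).
- move=> p pm; rewrite reconnected_arcsE (negbTE ml) eqxx /=.
  by rewrite (negbTE (_ : p != m.+1 :> nat)).
Qed.

(** Reading the eigenvector equation at a node that is not the first of its arc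
    gives the geometric profile along the arc; at the first node of the arc i it
    gives the equation for the end values [x].  The last clause sums a geometric
    profile over each arc. *)
Lemma arcs_eigenvector A l (v : 'rV[R[i]]_(\sum_i l i)) mu :
  (forall i, (0 < l i)%N) -> A^T = A ->
  v *m cmx (reconnected_arcs A l) = mu *: v ->
  exists x : 'rV[R[i]]_k,
    [/\ forall i m, v 0 (tagnat.Rank i m) = mu ^+ (l i - m.+1) * x 0 i,
        forall i, (x *m cmx A) 0 (ord_pred i) = mu ^+ l i * x 0 i &
        \sum_a v 0 a = \sum_i x 0 i * \sum_(m < l i) mu ^+ m].
Proof.
move=> l0 symA vG.
have last_lt i : ((l i).-1 < l i)%N by rewrite prednK.
pose lst i := Ordinal (last_lt i).
pose x : 'rV[R[i]]_k := \row_i v 0 (tagnat.Rank i (lst i)).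
have eqn i m : \sum_j \sum_(p < l j) v 0 (tagnat.Rank j p) *
    (reconnected_arcs A l (tagnat.Rank j p) (tagnat.Rank i m))%:C%C
    = mu * v 0 (tagnat.Rank i m).
  rewrite -(sum_nodes (fun a => v 0 a *
    (reconnected_arcs A l a (tagnat.Rank i m))%:C%C)).
  have /rowP/(_ (tagnat.Rank i m)) := vG; rewrite !mxE => <-.
  by apply: eq_bigr => a _; rewrite !mxE.
have inner i (m p : 'I_(l i)) : p = m.+1 :> nat ->
    v 0 (tagnat.Rank i m) = mu * v 0 (tagnat.Rank i p).
  move=> pm; rewrite -eqn (@sum_single_node _ l _ i m).
  - by rewrite reconnected_arcsE -pm ltn_eqF // !eqxx mulr1.
  - move=> j q ji; rewrite reconnected_arcsE pm /= [i == j]eq_sym (negbTE ji).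
    by rewrite if_same mulr0.
  - move=> q qm; rewrite reconnected_arcsE pm eqxx /= eqSS [_ == nat_of_ord q]eq_sym.
    by rewrite (negbTE (_ : q != m :> nat)) // if_same mulr0.
have vE i n (m : 'I_(l i)) : (l i - m.+1)%N = n -> v 0 (tagnat.Rank i m) = mu ^+ n * x 0 i.
  elim: n m => [|n IH] m mn.
    rewrite expr0 mul1r mxE; congr (v 0 (tagnat.Rank i _)); apply: val_inj => /=.
    have := ltn_ord m; move/eqP: mn; rewrite subn_eq0 => ? ?; apply/eqP.
    by rewrite -eqSS prednK // eqn_leq; apply/andP.
  have pl : (m.+1 < l i)%N by rewrite -subn_gt0 mn.
  rewrite (@inner i m (Ordinal pl)) // IH /= ?exprS ?mulrA //.
  by rewrite subnS mn.
exists x; split => [i m|i|]; first exact: vE.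
  have -> : mu ^+ l i * x 0 i = mu * v 0 (tagnat.Rank i (Ordinal (l0 i))).
    by rewrite (vE i _ _ erefl) mulrA -exprS /= subn1 prednK.
  rewrite -eqn mxE; apply: eq_bigr => j _; rewrite (bigD1 (lst j)) //=.
  rewrite reconnected_arcsE prednK // !eqxx /= [X in _ + X]big1 => [|q qm]; last first.
    rewrite reconnected_arcsE /= andbF ifF ?mulr0 //.
    by apply: contraNF qm => /eqP ql; apply/eqP/val_inj; rewrite /= -[X in _ = X.-1]ql.
  by rewrite addr0 !mxE -{1}symA mxE.
rewrite sum_nodes; apply: eq_bigr => i _; rewrite mulr_sumr.
rewrite (reindex_inj rev_ord_inj) /=; apply: eq_bigr => m _.
rewrite (vE i _ (rev_ord m) erefl) [RHS]mulrC /=.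
by rewrite subnSK // subKn // ltnW.
Qed.

End ArcNodes.

(** * The two obstructions to an eigenvalue of modulus near 1 *)

Section DeterministicBound.
Context {R : realType} {k : nat} (A : 'M[R]_k) (l : 'I_k -> nat).
Context (mu : R[i]) (x : 'rV[R[i]]_k) (Delta delta tau s T D : R) (M : nat).
Hypothesis k_gt0 : (0 < k)%N.
Hypothesis symA : A^T = A.
Hypothesis dsA : doubly_stochastic A.
Hypothesis irrA : irreducible_mx A.
Hypothesis gapA : Delta <= spectral_gap A.
Hypothesis l_bound : forall i, (0 < l i <= M)%N.
Hypothesis x_neq0 : x != 0.
Hypothesis xA : forall i, (x *m cmx A) 0 (ord_pred i) = mu ^+ l i * x 0 i.
Hypothesis x_sum : \sum_i x 0 i * \sum_(m < l i) mu ^+ m = 0.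

Let r := cmod mu.

Lemma sqnorm_step : sqnorm (x *m cmx A) = \sum_i (r ^+ l i) ^+ 2 * cmod (x 0 i) ^+ 2.
Proof.
rewrite /sqnorm (reindex_inj (@ord_pred_inj k)) /=; apply: eq_bigr => i _.
by rewrite xA cmodM cmodX exprMn.
Qed.

(** [x *m cmx A] is no longer than [x], while [|mu| > 1] would lengthen every
    coordinate, all lengths being positive. *)
Lemma cmod_le1 : r <= 1.
Proof.
rewrite leNgt; apply/negP => r1.
have := sqnorm_doubly_stochastic x dsA; apply/negP; rewrite -ltNge sqnorm_step.
apply: (@lt_le_trans _ _ (r * sqnorm x)).
  by rewrite ltr_pMl ?sqnorm_gt0.
rewrite mulr_sumr; apply: ler_sum => i _; apply: ler_wpM2r; first exact: sqr_ge0.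
rewrite -exprM -{1}(expr1 r) ler_eXn2l // muln_gt0 andbT.
by case/andP: (l_bound i).
Qed.

Let a : R[i] := (\sum_i x 0 i) / k%:R.
Let z : 'rV[R[i]]_k := x - const_mx a.

Let k_neq0 : (k%:R : R[i]) != 0.
Proof. by rewrite pnatr_eq0 -lt0n. Qed.

Let xE : x = const_mx a + z.
Proof. by rewrite addrC subrK. Qed.

Let z_sum : \sum_i z 0 i = 0.
Proof.
under eq_bigr do rewrite !mxE.
rewrite big_split /= sumrN sumr_const card_ord -[a *+ k]mulr_natr.
by rewrite divfK // subrr.
Qed.

Let zA_sum : \sum_i (z *m cmx A) 0 i = 0.
Proof.
under eq_bigr do rewrite mxE.
rewrite exchange_big /= -[RHS]z_sum; apply: eq_bigr => i _.
rewrite -mulr_sumr (eq_bigr (fun j => (A i j)%:C%C)) => [|j _]; last by rewrite mxE.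
by rewrite -rmorph_sum; case: dsA => _ -> _; rewrite mulr1.
Qed.

Let const_step : const_mx a *m cmx A = const_mx a :> 'rV[R[i]]_k.
Proof.
apply/rowP => j; rewrite !mxE.
rewrite (eq_bigr (fun i => a * (A i j)%:C%C)) => [|i _]; last by rewrite !mxE.
by rewrite -mulr_sumr -rmorph_sum; case: dsA => _ _ ->; rewrite mulr1.
Qed.

Let xAE : x *m cmx A = const_mx a + z *m cmx A.
Proof. by rewrite {1}xE mulmxDl const_step. Qed.

Let addE (w : 'rV[R[i]]_k) j : (const_mx a + w) 0 j = a + w 0 j.
Proof. by rewrite !mxE. Qed.

Let Q := k%:R * cmod a ^+ 2.
Let Z := sqnorm z.

Hypothesis r_gt : 1 - delta < r.
Hypothesis Delta_gt0 : 0 < Delta.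
Hypothesis delta_small : 4 * (M%:R * delta) <= Delta.

(** By Bernoulli's inequality the step [x *m cmx A] loses at most a proportion
    2 M delta of the squared norm; the gap makes it lose a proportion Delta of the
    fluctuating part. *)
Lemma fluctuation_le : Delta * Z <= 4 * (M%:R * delta) * Q.
Proof.
have r0 : 0 <= r by exact: cmod_ge0.
have r1 := cmod_le1.
have lo : (1 - 2 * (M%:R * delta)) * sqnorm x <= sqnorm (x *m cmx A).
  rewrite sqnorm_step mulr_sumr; apply: ler_sum => i _.
  apply: ler_wpM2r; first exact: sqr_ge0.
  rewrite -exprM.
  apply: le_trans (exprn_ge_bernoulli _ _); last by rewrite r0.
  rewrite natrM mulrC; case/andP: (l_bound i) => _.
  rewrite -(ler_nat R) => lM.
  have : (l i)%:R * (1 - r) <= M%:R * delta.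
    by have rgt := r_gt; apply: ler_pM => //; lra.
  lra.
have hi := sqnorm_gap symA dsA irrA gapA z_sum.
rewrite {1}xE xAE !sqnormD_mean0 // -/Q -/Z in lo.
rewrite -/Z in hi.
have Z0 : 0 <= Z by exact: sqnorm_ge0.
have := ler_wpM2r Z0 delta_small.
lra.
Qed.

Lemma mean_gt0 : 0 < Q.
Proof.
have Q0 : 0 <= Q by rewrite mulr_ge0 ?sqr_ge0.
rewrite lt_neqAle Q0 andbT; apply/eqP => Q0'.
have := fluctuation_le; rewrite -Q0' mulr0 => h.
have : 0 < sqnorm x by exact: sqnorm_gt0.
rewrite {1}xE sqnormD_mean0 // -/Q -/Z -Q0' add0r => Zp.
by have := mulr_gt0 Delta_gt0 Zp; lra.
Qed.

(** Subtracting the constant part from both sides of the equation for the end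
    values leaves a (1 - mu^(l_i)) on one side and fluctuations on the other. *)
Lemma mean_dispersion_le :
  cmod a ^+ 2 * \sum_i cmod (1 - mu ^+ l i) ^+ 2 <= 4 * Z.
Proof.
have eqi i : a * (1 - mu ^+ l i) = mu ^+ l i * z 0 i - (z *m cmx A) 0 (ord_pred i).
  have := xA i; rewrite xAE [in RHS]xE !addE => e.
  have -> : (z *m cmx A) 0 (ord_pred i) = mu ^+ l i * (a + z 0 i) - a.
    by rewrite -e addrC addKr.
  ring.
have h : sqnorm (z *m cmx A) <= Z by exact: sqnorm_doubly_stochastic.
apply: (@le_trans _ _ (2 * (Z + sqnorm (z *m cmx A)))); last lra.
rewrite mulr_sumr /Z /sqnorm [X in _ + X](reindex_inj (@ord_pred_inj k)) /=.
rewrite -big_split mulr_sumr /=; apply: ler_sum => i _.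
rewrite -exprMn -cmodM eqi; apply: le_trans (sqr_cmodD_le _ _) _.
rewrite cmodN cmodM cmodX ler_pM2l // lerD2r exprMn ler_piMl ?sqr_ge0 //.
by rewrite !exprn_ile1 ?exprn_ge0 ?cmod_ge0 ?cmod_le1.
Qed.

Hypothesis M_tau : M%:R * tau <= 2^-1.

(** When mu is close to 1 every h_i is at least l_i / 2 in real part, and the zero
    sum condition reads a sum_i h_i = - sum_i z_i h_i. *)
Lemma mean_mass_le : cmod (1 - mu) <= tau ->
  (cmod a * (\sum_i (l i)%:R)) ^+ 2 <= 4 * (k%:R * M%:R ^+ 2 * Z).
Proof.
move=> near1.
have mu1 : cmod mu <= 1 := cmod_le1.
pose h i := \sum_(m < l i) mu ^+ m.
have h1 i : cmod ((l i)%:R - h i) <= 2^-1 * (l i)%:R.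
  have -> : (l i)%:R - h i = \sum_(m < l i) (1 - mu ^+ m).
    by rewrite big_split /= sumrN sumr_const card_ord.
  apply: le_trans (cmod_sum _ _ _) _; rewrite mulr_natr -[X in _ *+ X]card_ord -sumr_const.
  apply: ler_sum => m _; apply: le_trans (cmod_1subX _ mu1) _; apply: le_trans M_tau.
  apply: ler_pM => //; first exact: cmod_ge0.
  rewrite ler_nat; apply: leq_trans (ltnW (ltn_ord m)) _.
  by case/andP: (l_bound i).
have h2 i : cmod (h i) <= M%:R.
  apply: le_trans (cmod_sum _ _ _) _.
  apply: (@le_trans _ _ (\sum_(m < l i) 1)).
    by apply: ler_sum => m _; rewrite cmodX exprn_ile1 ?cmod_ge0.
  by rewrite sumr_const card_ord ler_nat; case/andP: (l_bound i).
have lower : 2^-1 * \sum_i (l i)%:R <= cmod (\sum_i h i).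
  have e : \sum_i (l i)%:R = (\sum_i h i) + \sum_i ((l i)%:R - h i).
    by rewrite -big_split /=; apply: eq_bigr => i _; rewrite addrC subrK.
  have /(congr1 (@cmod R)) := e; rewrite -natr_sum cmod_nat => e'.
  have := cmodD (\sum_i h i) (\sum_i ((l i)%:R - h i)); rewrite -e'.
  have : cmod (\sum_i ((l i)%:R - h i)) <= 2^-1 * \sum_i (l i)%:R.
    by apply: le_trans (cmod_sum _ _ _) _; rewrite mulr_sumr; apply: ler_sum.
  by rewrite -natr_sum; lra.
have ah : a * \sum_i h i = - \sum_i z 0 i * h i.
  apply/eqP; rewrite -addr_eq0 mulr_sumr -big_split /= -[X in _ == X]x_sum; apply/eqP.
  apply: eq_bigr => i _; by rewrite [in RHS]xE addE mulrDl.
have upper : cmod a * cmod (\sum_i h i) <= M%:R * \sum_i cmod (z 0 i).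
  rewrite -cmodM ah cmodN; apply: le_trans (cmod_sum _ _ _) _.
  rewrite mulr_sumr; apply: ler_sum => i _; rewrite cmodM mulrC.
  by apply: ler_wpM2r; rewrite ?cmod_ge0.
have cs := sqr_sum_le (fun i => cmod (z 0 i)); rewrite card_ord -/(sqnorm z) -/Z in cs.
have a0 := cmod_ge0 a.
have S0 : 0 <= \sum_i (l i)%:R :> R by apply: sumr_ge0.
have le1 : cmod a * (2^-1 * \sum_i (l i)%:R) <= M%:R * \sum_i cmod (z 0 i).
  by apply: le_trans upper; exact: ler_wpM2l.
have le2 : (cmod a * (2^-1 * \sum_i (l i)%:R)) ^+ 2 <= (M%:R * \sum_i cmod (z 0 i)) ^+ 2.
  rewrite ler_sqr ?nnegrE //; first by rewrite !mulr_ge0.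
  by apply: le_trans le1; rewrite !mulr_ge0.
have := ler_wpM2l (sqr_ge0 (M%:R : R)) cs.
move: le2; rewrite !exprMn => le2 le3.
lra.
Qed.

(** T stands for the number of blocks, s for the closeness scale to 1, and D for a
    length which one arc in each block exceeds. *)
Hypothesis s_ge0 : 0 <= s.
Hypothesis T_ge0 : 0 <= T.
Hypothesis D_ge0 : 0 <= D.
Hypothesis far : tau <= cmod (1 - mu) -> T * s ^+ 2 <= \sum_i cmod (1 - mu ^+ l i) ^+ 2.
Hypothesis mass : T * D <= \sum_i (l i)%:R.
Hypothesis num_far : 16 * (M%:R * delta) * k%:R < Delta * s ^+ 2 * T.
Hypothesis num_near :
  16 * M%:R ^+ 3 * delta * k%:R ^+ 2 < Delta * (T * D) ^+ 2.

Lemma deterministic_contradiction : False.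
Proof.
have Qgt := mean_gt0.
have fl := fluctuation_le.
have a2 : 0 <= cmod a ^+ 2 := sqr_ge0 _.
have k0 : 0 < (k%:R : R) by rewrite ltr0n.
have [/far hf|/ltW near1] := leP tau (cmod (1 - mu)).
  have h1 := le_trans (ler_wpM2l a2 hf) mean_dispersion_le.
  have h2 := ler_wpM2l (ltW Delta_gt0) h1.
  have h3 := ler_wpM2l (ltW k0) h2.
  have h4 := ler_wpM2l (ltW k0) fl.
  have h5 : 16 * (M%:R * delta) * k%:R * Q < Delta * s ^+ 2 * T * Q.
    by rewrite ltr_pM2r.
  rewrite /Q in h3 h4 h5; nra.
have h1 := mean_mass_le near1.
have h2 : (cmod a * (T * D)) ^+ 2 <= (cmod a * \sum_i (l i)%:R) ^+ 2.
  have a0 := cmod_ge0 a.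
  have TD0 : 0 <= T * D by exact: mulr_ge0.
  rewrite ler_sqr ?nnegrE; first exact: ler_wpM2l.
    exact: mulr_ge0.
  by apply: mulr_ge0 => //; apply: le_trans mass.
have h3 := ler_wpM2l (ltW Delta_gt0) (le_trans h2 h1).
have h4 : 16 * M%:R ^+ 3 * delta * k%:R ^+ 2 * Q < Delta * (T * D) ^+ 2 * Q.
  by rewrite ltr_pM2r.
have M2 : 0 <= 4 * k%:R * M%:R ^+ 2 :> R by rewrite !mulr_ge0.
have h5 := ler_wpM2l (ltW k0) (ler_wpM2l M2 fl).
have h6 := ler_wpM2l (ltW k0) h3.
rewrite /Q in h4 h5; rewrite exprMn in h6; nra.
Qed.

End DeterministicBound.

(** * From eigenvectors of zero sum to the spectral gap *)

Section GapFromEigenvectors.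
Context {R : realType} {n : nat}.
Implicit Type G : 'M[R]_n.

Lemma mulmx_ones m (v : 'M[R[i]]_(m, n)) i :
  (v *m (const_mx 1 : 'cV_n)) i 0 = \sum_j v i j.
Proof. by rewrite mxE; apply: eq_bigr => j _; rewrite mxE mulr1. Qed.

Lemma cmx_ones G : (forall a, \sum_b G a b = 1) ->
  cmx G *m (const_mx 1 : 'cV_n) = const_mx 1.
Proof.
move=> G1; apply/colP => a; rewrite mulmx_ones [RHS]mxE.
rewrite (eq_bigr (fun b => (G a b)%:C%C)) => [|b _]; last by rewrite mxE.
by rewrite -rmorph_sum G1.
Qed.

(** An eigenvector for an eigenvalue other than 1 has zero sum.  Conversely the
    space of zero-sum vectors is stable and nonzero, so it contains an
    eigenvector; this makes the set of eigenvalues in the definition of the gap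
    nonempty, as needed for its infimum to be informative. *)
Lemma spectral_gap_ge G (delta : R) : (1 < n)%N -> 0 < delta ->
  (forall a, \sum_b G a b = 1) ->
  (forall mu (v : 'rV_n), v != 0 -> v *m cmx G = mu *: v -> \sum_a v 0 a = 0 ->
    cmod mu <= 1 - delta) ->
  delta <= spectral_gap G.
Proof.
move=> n1 d0 G1 hv; apply: lb_le_inf; last first.
  move=> _ [mu [/eigenvalueP[v vG v0] mu1] <-].
  rewrite lerBrDl -lerBrDr; apply: (hv mu v) => //.
  have e : (mu - 1) * \sum_a v 0 a = 0.
    have : mu *: (v *m (const_mx 1 : 'cV_n)) = v *m (const_mx 1 : 'cV_n).
      by rewrite scalemxAl -vG -mulmxA cmx_ones.
    move/(congr1 (fun X : 'M[R[i]]_1 => X 0 0)).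
    by rewrite [LHS]mxE !mulmx_ones mulrBl mul1r => ->; rewrite subrr.
  by move/eqP: e; rewrite mulf_eq0 subr_eq0 => /orP[/eqP|/eqP].
(* nonemptiness: an eigenvector in the stable space V of zero-sum vectors *)
pose V : 'M[R[i]]_n := kermx (const_mx 1 : 'cV_n).
have VG : (V *m cmx G <= V)%MS.
  by apply/sub_kermxP; rewrite -mulmxA cmx_ones // mulmx_ker.
have rV : (0 < \rank V)%N.
  by rewrite mxrank_ker subn_gt0; apply: leq_ltn_trans n1; exact: rank_leq_col.
have [mu] := eigenvalue_closed (complex.restrict V (cmx G)) rV.
move=> /eigenvalueP[u /eigenspaceP].
rewrite complex.eigenspace_restrict // => /eigenspaceP uG u0.
exists (1 - complex.Re `|mu|), mu => //; split.
  apply/eigenvalueP; exists (u *m row_base V) => //.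
  by rewrite mul_mx_rowfree_eq0 ?row_base_free.
have w0 : u *m row_base V != 0 by rewrite mul_mx_rowfree_eq0 ?row_base_free.
have /(hv _ _ w0 uG) : \sum_a (u *m row_base V) 0 a = 0.
  have : (u *m row_base V <= V)%MS by rewrite mulmx_sub // eq_row_base.
  by move/sub_kermxP/matrixP/(_ 0 0); rewrite mulmx_ones mxE.
by move=> h mu1; move: h; rewrite mu1 cmod1; lra.
Qed.

End GapFromEigenvectors.

(** * A net of the unit disk *)

Section Net.
Context {R : realType}.

Definition grid_point (N : nat) (p : (bool * 'I_N.+1) * (bool * 'I_N.+1)) : R[i] :=
  Complex ((-1) ^+ p.1.1 * (p.1.2%:R / N%:R)) ((-1) ^+ p.2.1 * (p.2.2%:R / N%:R)).

(** Rounding is towards 0, so that the grid point stays in the unit disk and its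
    powers remain Lipschitz with constant n. *)
Lemma coord_approx N (x : R) : (0 < N)%N -> `|x| <= 1 ->
  exists p : bool * 'I_N.+1, let y := (-1) ^+ p.1 * (p.2%:R / N%:R) in
    `|y| <= `|x| /\ `|x - y| <= N%:R^-1.
Proof.
move=> N0 x1; have N0' : 0 < N%:R :> R by rewrite ltr0n.
have Nx0 : 0 <= N%:R * `|x| by rewrite mulr_ge0.
have /andP[t1 t2] := truncn_itv Nx0.
have tN : (Num.truncn (N%:R * `|x|) < N.+1)%N.
  by rewrite ltnS -(ler_nat R); apply: le_trans t1 _; rewrite ler_piMr // ltW.
exists (x < 0, Ordinal tN) => /=.
move: t1 t2; rewrite -natr1.
move: (Num.truncn _)%:R (@ler0n R (Num.truncn (N%:R * `|x|))) => t t0 t1 t2.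
have q1 : t / N%:R <= `|x| by rewrite ler_pdivrMr // mulrC.
have q0 : 0 <= t / N%:R by rewrite divr_ge0 // ltW.
have q2 : `|x| <= t / N%:R + N%:R^-1.
  by rewrite -{2}[N%:R^-1]mul1r -mulrDl ler_pdivlMr // mulrC ltW.
rewrite normrMsign ger0_norm //; split => //.
rewrite {1}[x]realEsign ?num_real // -mulrBr normrMsign ger0_norm ?subr_ge0 //.
by rewrite lerBlDl.
Qed.

Lemma grid_approx N (mu : R[i]) : (0 < N)%N -> cmod mu <= 1 ->
  exists p, cmod (grid_point (N := N) p) <= 1 /\ cmod (mu - grid_point p) <= 2 / N%:R.
Proof.
move=> N0 mu1; have N0' : 0 < N%:R :> R by rewrite ltr0n.
have s1 : complex.Re mu ^+ 2 + complex.Im mu ^+ 2 <= 1.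
  by rewrite -sqr_cmodE expr_le1 ?cmod_ge0.
have sq x : 0 <= x -> x ^+ 2 <= 1 -> x <= 1 :> R by move=> x0; rewrite expr_le1.
have re1 : `|complex.Re mu| <= 1.
  by apply: sq; rewrite // real_normK ?num_real //; have := sqr_ge0 (complex.Im mu); lra.
have im1 : `|complex.Im mu| <= 1.
  by apply: sq; rewrite // real_normK ?num_real //; have := sqr_ge0 (complex.Re mu); lra.
have [p /= [p1 p2]] := coord_approx N0 re1.
have [q /= [q1 q2]] := coord_approx N0 im1.
have sqn (x y : R) : `|x| <= y -> x ^+ 2 <= y ^+ 2.
  by move=> xy; rewrite -[x ^+ 2]real_normK ?num_real // ler_sqr ?nnegrE // (le_trans _ xy).
exists (p, q); split.
  apply: sq; rewrite ?cmod_ge0 // sqr_cmodE /=; apply: le_trans s1.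
  rewrite -[complex.Re mu ^+ 2]real_normK ?num_real //.
  rewrite -[complex.Im mu ^+ 2]real_normK ?num_real //.
  by apply: lerD; exact: sqn.
rewrite -ler_sqr ?nnegrE ?cmod_ge0 ?divr_ge0 //.
rewrite sqr_cmodE /grid_point /=.
have -> : (2 / N%:R) ^+ 2 = 4 * N%:R^-1 ^+ 2 :> R by ring.
have := sqn _ _ p2; have := sqn _ _ q2; have := sqr_ge0 (N%:R^-1 : R).
by case: mu {mu1 s1 re1 im1 p1 p2 q1 q2} => a b /=; lra.
Qed.

Lemma cmod_subX (z w : R[i]) m : cmod z <= 1 -> cmod w <= 1 ->
  cmod (z ^+ m - w ^+ m) <= m%:R * cmod (z - w).
Proof.
move=> z1 w1; elim: m => [|m IH]; first by rewrite !expr0 subrr cmod0 mul0r.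
have -> : z ^+ m.+1 - w ^+ m.+1 = (z - w) * z ^+ m + w * (z ^+ m - w ^+ m).
  by rewrite !exprS; ring.
rewrite -natr1 [leRHS]mulrDl mul1r [leRHS]addrC; apply: le_trans (cmodD _ _) _.
rewrite !cmodM cmodX lerD //.
  by rewrite ler_piMr ?cmod_ge0 // exprn_ile1 ?cmod_ge0.
by apply: le_trans IH; rewrite ler_piMl ?cmod_ge0.
Qed.

(** If all powers w^d with d <= D were close to 1, so would be their average, whose
    modulus is |1 - w^D| / (D |1 - w|); this forces 1 - w to be of order 1/D. *)
Lemma far_from_one_power (w : R[i]) (D : nat) (s : R) :
  (0 < D)%N -> s <= 16^-1 -> 16 * s / D%:R <= cmod (1 - w) ->
  exists2 d, (0 < d <= D)%N & 8 * s <= cmod (1 - w ^+ d).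
Proof.
move=> D0 s16 hw; have D0' : 0 < D%:R :> R by rewrite ltr0n.
apply: contrapT => hn.
have hd d : (d <= D)%N -> (0 < d)%N -> cmod (1 - w ^+ d) < 8 * s.
  by move=> dD d0; rewrite ltNge; apply/negP => h; apply: hn; exists d; rewrite ?d0.
have s0 : 0 < s by have := hd 1%N D0 isT; have := cmod_ge0 (1 - w ^+ 1); lra.
pose S := \sum_(m < D) w ^+ m.
have SD : cmod (D%:R - S) <= D%:R * 2^-1.
  have -> : D%:R - S = \sum_(m < D) (1 - w ^+ m).
    by rewrite big_split /= sumrN sumr_const card_ord.
  apply: le_trans (cmod_sum _ _ _) _; rewrite mulr_natl -[X in _ *+ X]card_ord -sumr_const.
  apply: ler_sum => -[[|m] mD] _ /=; first by rewrite expr0 subrr cmod0.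
  by have := hd m.+1 (ltnW mD) isT; lra.
have Slow : D%:R * 2^-1 <= cmod S.
  have := cmodD S (D%:R - S); rewrite addrC subrK cmod_nat => ?.
  by have := SD; lra.
have prod : cmod (1 - w) * cmod S < 8 * s.
  rewrite -cmodM.
  have -> : (1 - w) * S = 1 - w ^+ D.
    by apply: oppr_inj; rewrite -mulNr !opprB subrX1.
  exact: hd.
have : 16 * s / D%:R * (D%:R * 2^-1) <= cmod (1 - w) * cmod S.
  apply: ler_pM => //.
  by apply: divr_ge0 => //; apply: mulr_ge0 => //; exact: ltW.
rewrite mulrA divfK ?gt_eqF //; lra.
Qed.

(** w^(n+d) - w^n = - w^n (1 - w^d) is not small, so w^n and w^(n+d) cannot both be
    close to 1. *)
Lemma far_power_shift (w : R[i]) (s : R) (d n : nat) :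
  s <= 4^-1 -> 8 * s <= cmod (1 - w ^+ d) ->
  cmod (1 - w ^+ n) < 2 * s -> 2 * s <= cmod (1 - w ^+ (n + d)).
Proof.
move=> s4 hd hn; rewrite leNgt; apply/negP => hnd.
have e : w ^+ n * (1 - w ^+ d) = (1 - w ^+ (n + d)) - (1 - w ^+ n).
  by rewrite exprD; ring.
have := cmodB (1 - w ^+ (n + d)) (1 - w ^+ n); rewrite -e cmodM.
have := cmodD (w ^+ n) (1 - w ^+ n); rewrite addrC subrK cmod1.
have := cmod_ge0 (w ^+ n); have := cmod_ge0 (1 - w ^+ n).
move: (cmod (w ^+ n)) (cmod (1 - w ^+ d)) (cmod (1 - w ^+ n))
  (cmod (1 - w ^+ (n + d))) hd hn hnd => a b c e' hd hn hnd c0 a0 h1 h2.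
have s0 : 0 < s by lra.
have a2 : 2^-1 <= a by lra.
have ab : 2^-1 * (8 * s) <= a * b by apply: ler_pM => //; lra.
by move: h1 h2; lra.
Qed.

End Net.

(** * Typical lengths and the resulting gap *)

Section GoodLengths.
Context {R : realType} {k : nat}.
Implicit Types (A : 'M[R]_k) (l : 'I_k -> nat).

(** A substitute for a law of large numbers uniform over a large family of sets:
    weaker by a factor of the order of [b], but a union bound suffices for it. *)
Definition blocks_hit (b : nat) l (S : set nat) : Prop :=
  forall t, (t < k %/ b)%N -> exists2 i : 'I_k, (i %/ b)%N = t & S (l i).

Lemma blocks_hit_sum b l (S : set nat) (F : 'I_k -> R) (c : R) :
  blocks_hit b l S -> (forall i, 0 <= F i) -> (forall i, S (l i) -> c <= F i) ->
  (k %/ b)%:R * c <= \sum_i F i.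
Proof.
move=> hS F0 Fc.
apply: (@le_trans _ _ (\sum_(i < k) \sum_(t < (k %/ b)%N | (i %/ b)%N == t) F i)).
  rewrite (exchange_big_dep xpredT) //= mulr_natl -[X in _ *+ X]card_ord -sumr_const.
  apply: ler_sum => t _; have [i it Si] := hS t (ltn_ord t).
  rewrite (bigD1 i) /= ?it // -[leLHS]addr0; apply: lerD; first exact: Fc.
  exact: sumr_ge0.
apply: ler_sum => i _; have [it|it] := ltnP (i %/ b) (k %/ b).
  by rewrite (big_pred1 (Ordinal it)) // => t; rewrite eq_sym.
by rewrite big_pred0 // => t; apply/negbTE; rewrite neq_ltn (leq_trans _ it) ?orbT.
Qed.

(** The condition on [M * (2 / N)] bounds the error made on mu^(l_i) when mu is
    replaced by a nearby grid point; half of the separation [2 * s] survives. *)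
Lemma spectral_gap_reconnected_arcs_ge A l (Delta delta s : R) (M D N b : nat) :
  (1 < k)%N -> A^T = A -> doubly_stochastic A -> irreducible_mx A ->
  Delta <= spectral_gap A -> 0 < Delta -> 0 < delta ->
  (0 < D)%N -> (0 < N)%N -> 0 < s -> 
  M%:R * (2 / N%:R) <= s ->
  M%:R * (16 * s / D%:R + 2 / N%:R) <= 2^-1 ->
  4 * (M%:R * delta) <= Delta ->
  16 * (M%:R * delta) * k%:R < Delta * s ^+ 2 * (k %/ b)%:R ->
  16 * M%:R ^+ 3 * delta * k%:R ^+ 2 < Delta * ((k %/ b)%:R * D%:R) ^+ 2 ->
  (forall i, (0 < l i <= M)%N) ->
  blocks_hit b l [set n | (D < n)%N] ->
  (forall p, 16 * s / D%:R <= cmod (1 - grid_point (R := R) (N := N) p) ->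
    blocks_hit b l [set n | 2 * s <= cmod (1 - grid_point (R := R) p ^+ n)]) ->
  delta <= spectral_gap (reconnected_arcs A l).
Proof.
move=> k1 symA dsA irrA gapA De0 de0 D0 N0 s0 MN Mtau Mde nfar nnear lM hitD hitN.
have l0 i : (0 < l i)%N by case/andP: (lM i).
apply: spectral_gap_ge => //.
- apply: leq_trans k1 _; rewrite -[X in (X <= _)%N]card_ord -sum1_card.
  exact: leq_sum.
- exact: reconnected_arcs_row_sum.
move=> mu v v0 vG vsum; have [x [vx xA xsum]] := arcs_eigenvector l0 symA vG.
rewrite vsum in xsum.
have x0 : x != 0.
  apply: contraNneq v0 => x0; apply/eqP/rowP => a; rewrite [RHS]mxE.
  by rewrite -[a]tagnat.sig2K vx x0 mxE mulr0.
rewrite leNgt; apply/negP => mu_gt.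
have mu1 : cmod mu <= 1 by apply: cmod_le1 xA => //.
apply: (@deterministic_contradiction R k A l mu x Delta delta
  (16 * s / D%:R + 2 / N%:R) s (k %/ b)%:R D%:R M) => //.
- exact: ltnW.
- move=> near; have [p [p1 p2]] := grid_approx N0 mu1.
  have hp : 16 * s / D%:R <= cmod (1 - grid_point (R := R) p).
    have := cmodD (1 - grid_point p) (grid_point p - mu).
    rewrite addrA subrK [cmod (grid_point p - mu)]cmodBC; lra.
  apply: (blocks_hit_sum (hitN p hp)) => i; first exact: sqr_ge0.
  move=> /= hi; rewrite ler_sqr ?nnegrE ?cmod_ge0 //; last exact: ltW.
  have := cmodD (1 - mu ^+ l i) (mu ^+ l i - grid_point p ^+ l i).
  rewrite addrA subrK.
  have := cmod_subX (l i) mu1 p1.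
  have : (l i)%:R * cmod (mu - grid_point p) <= M%:R * (2 / N%:R).
    apply: ler_pM => //; first exact: cmod_ge0.
    by rewrite ler_nat; case/andP: (lM i).
  lra.
- apply: (blocks_hit_sum hitD) => i //= Di.
  by rewrite ler_nat ltnW.
Qed.

End GoodLengths.

(** * Events depending on finitely many integer random variables *)

Section FiniteEvents.
Context d (T : measurableType d) (R : realType) (P : probability T R).

Lemma union_bound (I : finType) (F : I -> set T) : (forall i, measurable (F i)) ->
  measurable [set w | exists i, F i w] /\
  (P [set w | exists i, F i w] <= \sum_i P (F i))%E.
Proof.
move=> mF.
have key (s : seq I) : measurable (\big[setU/set0]_(i <- s) F i) /\
    (P (\big[setU/set0]_(i <- s) F i) <= \sum_(i <- s) P (F i))%E.
  elim: s => [|i s [ms hs]]; first by rewrite !big_nil measure0.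
  rewrite !big_cons; split; first exact: measurableU.
  apply: le_trans (measureU2 _ _ _) _ => //.
  exact: leeD2l.
suff -> : [set w | exists i, F i w] = \big[setU/set0]_i F i by exact: key.
rewrite -bigcup_seq; apply/seteqP; split => w /= [j].
  by exists j; rewrite //= mem_index_enum.
by exists j.
Qed.

(** The vector of lengths takes countably many values. *)
Lemma measurable_of_lengths k (X : 'I_k -> {RV P >-> nat})
    (Q : ('I_k -> nat) -> Prop) :
  measurable [set w | Q (fun i => X i w)].
Proof.
have -> : [set w | Q (fun i => X i w)] =
    \bigcup_(n in [set n | exists2 f : {ffun 'I_k -> nat},
                             unpickle n = Some f & Q f])
      [set w | unpickle n = Some [ffun i => X i w]].
  apply/seteqP; split => w /=.
    move=> Qw; exists (pickle [ffun i => X i w]); last by rewrite /= pickleK.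
    exists [ffun i => X i w]; first by rewrite pickleK.
    suff -> : fun_of_fin [ffun i => X i w] = (fun i => X i w) by [].
    by apply/funext => i; rewrite ffunE.
  move=> [n [f nf Qf] /=]; rewrite nf => -[fE].
  suff -> : (fun i => X i w) = f by [].
  by apply/funext => i; rewrite fE ffunE.
apply: bigcup_measurable => n [f nf Qf].
have -> : [set w | unpickle n = Some [ffun i => X i w]] =
    \bigcap_(i in [set: 'I_k]) X i @^-1` [set f i].
  apply/seteqP; split => w /=; rewrite nf.
    by move=> [->] i _ /=; rewrite ffunE.
  by move=> h; congr Some; apply/ffunP => j; rewrite ffunE -(h j).
by apply: fin_bigcap_measurable => // i _; exact: measurable_funPTI.
Qed.

End FiniteEvents.

(** * The geometric law *)

Section GeometricLaw.
Context d (T : measurableType d) (R : realType) (P : probability T R).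
Context (p : R) (X : {RV P >-> nat}).
Hypothesis geoX : geometric_rv p X.

Let mX (S : set nat) : measurable (X @^-1` S).
Proof. exact: measurable_funPTI. Qed.

Lemma geometric_positive : P (X @^-1` [set 0%N]) = 0%E.
Proof. exact: (geoX 0). Qed.

(** Lack of memory of the geometric law. *)
Lemma geometric_shift (S : set nat) n : S `<=` [set m | (0 < m)%N] ->
  P (X @^-1` [set (m + n)%N | m in S]) = (((1 - p) ^+ n)%:E * P (X @^-1` S))%E.
Proof.
move=> S0; pose mu : probability _ R := distribution P X.
have E (g : nat -> nat) : injective g ->
    P (X @^-1` [set g m | m in S]) =
    (\big[+%E/0%E]_(0 <= m <oo | m \in S) P (X @^-1` [set g m]))%E.
  move=> gI; rewrite -[LHS]/(mu [set g m | m in S]) -bigcup_imset1.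
  by rewrite measure_bigcup //; apply/trivIsetP => i j _ _ /eqP ij;
    apply/seteqP; split => // m /= [-> /gI].
rewrite E; last exact: addIn.
rewrite -{2}[S]image_id E // -nneseriesZl //.
apply: eq_eseriesr => m /set_mem /S0 m0.
have h1 := geoX (m + n)%N; have h2 := geoX m.
move: h1 h2; rewrite /distribution /pushforward => -> ->.
case: m m0 => // m _; rewrite addSn -EFinM exprD; congr EFin; ring.
Qed.

Lemma geometric_tail n : P (X @^-1` [set m | (n < m)%N]) = ((1 - p) ^+ n)%:E.
Proof.
have -> : [set m | (n < m)%N] = [set (m + n)%N | m in [set m | (0 < m)%N]].
  apply/seteqP; split => m /=; last by move=> [m' m0 <-]; rewrite -{1}[n]add0n ltn_add2r.
  by move=> nm; exists (m - n)%N; rewrite /= ?subn_gt0 // subnK // ltnW.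
rewrite geometric_shift //.
suff -> : P (X @^-1` [set m | (0 < m)%N]) = 1%E by rewrite mule1.
have -> : X @^-1` [set m | (0 < m)%N] = ~` (X @^-1` [set 0%N]).
  by apply/seteqP; split => w /=; case: (X w).
by rewrite probability_setC // geometric_positive sube0.
Qed.

(** Translating S by n costs a factor at most 2 and lands in the complement of S, so
    P(S) <= 2 P(complement of S). *)
Lemma geometric_escape (S : set nat) n : 2^-1 <= (1 - p) ^+ n ->
  (forall m, S m -> ~ S (m + n)%N) -> (3^-1%:E <= P (X @^-1` (~` S)))%E.
Proof.
move=> hn hS; pose S' := S `&` [set m | (0 < m)%N].
have e1 := @geometric_shift S' n (@subIsetr _ _ _).
have le1 : (P (X @^-1` [set (m + n)%N | m in S']) <= P (X @^-1` (~` S)))%E.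
  apply: le_measure; rewrite ?inE //.
  by move=> w /= [m [Sm _] <-]; exact: hS.
have le2 : (P (X @^-1` S) <= P (X @^-1` S'))%E.
  have : (P (X @^-1` S) <= P (X @^-1` S' `|` X @^-1` [set 0%N]))%E.
    apply: le_measure; rewrite ?inE //; first exact: measurableU.
    move=> w /= Sw; have [x0|x0] := posnP (X w); [by right|by left].
  move=> /le_trans; apply.
  apply: (@le_trans _ _ (P (X @^-1` S') + P (X @^-1` [set 0%N]))%E).
    exact: measureU2.
  by rewrite geometric_positive adde0.
rewrite preimage_setC probability_setC // in le1 *.
move: e1 le1 le2.
rewrite -[P (X @^-1` S')]fineK ?fin_num_measure //.
rewrite -[P (X @^-1` S)]fineK ?fin_num_measure //.
move=> -> ; rewrite -EFinM -EFinB !lee_fin.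
have := fine_ge0 (measure_ge0 P (X @^-1` S')).
move: (fine _) (fine _) ((1 - p) ^+ n) hn => x y z; nra.
exact: (mX S).
Qed.

End GeometricLaw.

(** * Probability of typical lengths *)

Section GoodLengthsProbability.
Context d (T : measurableType d) (R : realType) (P : probability T R).
Context (k : nat) (p : R) (X : 'I_k -> {RV P >-> nat}).
Hypothesis geoX : forall i, geometric_rv p (X i).
Hypothesis indX : independent_rvs X.

Let mX i (S : set nat) : measurable (X i @^-1` S).
Proof. exact: measurable_funPTI. Qed.

Lemma card_block (b t : nat) : (t < k %/ b)%N ->
  (b <= #|[set i : 'I_k | (i %/ b)%N == t]%SET|)%N.
Proof.
move=> tk; have b0 : (0 < b)%N by case: b tk => //; rewrite divn0.
have lt (r : 'I_b) : (t * b + r < k)%N.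
  apply: leq_trans (leq_trunc_div k b); apply: (@leq_trans (t.+1 * b)).
    by rewrite mulSn addnC ltn_add2r.
  by rewrite leq_mul2r tk orbT.
rewrite -[X in (X <= _)%N]card_ord.
rewrite -(card_imset _ (_ : injective (fun r => Ordinal (lt r)))).
  apply: subset_leq_card; apply/fintype.subsetP => _ /imsetP[r _ ->].
  by rewrite inE /= divnMDl // divn_small ?addn0.
by move=> r r' /(congr1 val) /= /addnI /val_inj.
Qed.

Lemma block_miss_prob (b t : nat) (S : set nat) (q : R) : (t < k %/ b)%N ->
  0 <= q <= 1 -> (forall i, (q%:E <= P (X i @^-1` S))%E) ->
  (P [set w | forall i : 'I_k, (i %/ b)%N = t -> ~ S (X i w)] <= ((1 - q) ^+ b)%:E)%E.
Proof.
move=> tk /andP[q0 q1] hS; pose J := [set i : 'I_k | (i %/ b)%N == t]%SET.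
have -> : [set w | forall i : 'I_k, (i %/ b)%N = t -> ~ S (X i w)] =
    \bigcap_(i in [set` J]) X i @^-1` (~` S).
  apply/seteqP; split => w h i.
    by move=> iJ; apply: h; apply/eqP; move: iJ; rewrite /= inE.
  by move=> it; apply: h; rewrite /= inE it eqxx.
rewrite (@indX J (fun=> ~` S)) //.
pose y i := fine (P (X i @^-1` (~` S))).
have yE i : P (X i @^-1` (~` S)) = (y i)%:E by rewrite fineK ?fin_num_measure.
rewrite (eq_bigr (fun i => (y i)%:E)) => [|i _]; last exact: yE.
rewrite prodEFin lee_fin.
have y0 i : 0 <= y i by rewrite fine_ge0.
have yq i : y i <= 1 - q.
  rewrite -lee_fin -yE preimage_setC probability_setC; last exact: mX.
  rewrite EFinB.
  by apply: leeB => //; exact: hS.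
apply: (@le_trans _ _ (\prod_(i in J) (1 - q))).
  by apply: ler_prod => i _; rewrite y0 yq.
rewrite prodr_const; apply: ler_wiXn2l; last exact: card_block.
  by rewrite subr_ge0.
by rewrite lerBlDr lerDl.
Qed.

Lemma good_lengths_prob (I : finType) (F : I -> set nat) (q : R) (b M : nat) :
  0 <= q <= 1 -> (forall i f, (q%:E <= P (X i @^-1` F f))%E) ->
  (P [set w | ~ ((forall i, (0 < X i w <= M)%N) /\
               forall f, blocks_hit b (fun i => X i w) (F f))] <=
   (k%:R * (1 - p) ^+ M + #|I|%:R * (k%:R * (1 - q) ^+ b))%:E)%E.
Proof.
move=> /andP[q0 q1] hF.
pose B1 i : set T := X i @^-1` [set m | ~ (0 < m <= M)%N].
pose B2 (f : I) (t : 'I_(k %/ b)) : set T :=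
  [set w | forall i : 'I_k, (i %/ b)%N = t -> ~ F f (X i w)].
have mB2 f t : measurable (B2 f t).
  exact: (measurable_of_lengths X
    (fun l => forall i : 'I_k, (i %/ b)%N = t -> ~ F f (l i))).
have [m1 u1] := @union_bound _ _ _ P _ B1 (fun i => mX i _).
have U2 f := @union_bound _ _ _ P _ (B2 f) (mB2 f).
have [m2 u2] := @union_bound _ _ _ P _
  (fun f => [set w | exists t, B2 f t w]) (fun f => (U2 f).1).
apply: (@le_trans _ _ (P ([set w | exists i, B1 i w] `|`
    [set w | exists f, exists t, B2 f t w]))).
  apply: le_measure; rewrite ?inE.
  - exact: (measurable_of_lengths X (fun l => ~ ((forall i, (0 < l i <= M)%N) /\
               forall f, blocks_hit b l (F f)))).
  - exact: measurableU.
  move=> w /= nw; apply: contrapT => /not_orP[n1 n2]; apply: nw; split.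
    by move=> i; apply: contrapT => h; apply: n1; exists i.
  move=> f t tk; apply: contrapT => h; apply: n2; exists f, (Ordinal tk) => i it Fi.
  by apply: h; exists i.
apply: le_trans (measureU2 _ m1 m2) _.
rewrite EFinD; apply: leeD.
  apply: le_trans u1 _; apply: (@le_trans _ _ (\sum_(i < k) ((1 - p) ^+ M)%:E)%E).
    apply: lee_sum => i _.
    rewrite /B1 (_ : [set m | _] = [set 0%N] `|` [set m | (M < m)%N]).
      rewrite preimage_setU; apply: (@le_trans _ _
        (P (X i @^-1` [set 0%N]) + P (X i @^-1` [set m | (M < m)%N]))%E).
        exact: measureU2.
      by rewrite (geometric_positive (geoX i)) (geometric_tail (geoX i)) add0e.
    apply/seteqP; split => m /=; last first.
      by case=> [->|Mm] // /andP[_]; rewrite leqNgt Mm.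
    by case: m => [|m] /=; [left | move/negP; rewrite -ltnNge; right].
  by rewrite sumEFin sumr_const card_ord mulr_natl lexx.
apply: le_trans u2 _.
apply: (@le_trans _ _ (\sum_(f : I) (k%:R * (1 - q) ^+ b)%:E)%E).
  apply: lee_sum => f _; apply: le_trans (U2 f).2 _.
  apply: (@le_trans _ _ (\sum_(t < (k %/ b)%N) ((1 - q) ^+ b)%:E)%E).
    by apply: lee_sum => t _; apply: block_miss_prob => //; rewrite ?q0.
  rewrite sumEFin sumr_const card_ord lee_fin -[leLHS]mulr_natl.
  apply: ler_wpM2r; first by rewrite exprn_ge0 ?subr_ge0.
  by rewrite ler_nat leq_div.
by rewrite sumEFin sumr_const -(mulr_natl (k%:R * _)).
Qed.

End GoodLengthsProbability.

(** * The gap with explicit parameters *)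

Section GapProbability.
Context d (T : measurableType d) (R : realType) (P : probability T R).
Context (k : nat) (p : R) (X : 'I_k -> {RV P >-> nat}).

Lemma spectral_gap_probability (A : 'M[R]_k) (Delta delta s : R) (M D N b : nat) :
  (forall i, geometric_rv p (X i)) -> independent_rvs X ->
  (1 < k)%N -> A^T = A -> doubly_stochastic A -> irreducible_mx A ->
  Delta <= spectral_gap A -> 0 < Delta -> 0 < delta ->
  (0 < D)%N -> (0 < N)%N -> 0 < s <= 16^-1 -> 0 <= p <= 1 -> D%:R * p <= 2^-1 ->
  M%:R * (2 / N%:R) <= s ->
  M%:R * (16 * s / D%:R + 2 / N%:R) <= 2^-1 ->
  4 * (M%:R * delta) <= Delta ->
  16 * (M%:R * delta) * k%:R < Delta * s ^+ 2 * (k %/ b)%:R ->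
  16 * M%:R ^+ 3 * delta * k%:R ^+ 2 < Delta * ((k %/ b)%:R * D%:R) ^+ 2 ->
  ((1 - (k%:R * (1 - p) ^+ M +
      (4 * N.+1%:R ^+ 2 + 1) * (k%:R * (2 / 3) ^+ b)))%:E <=
   P [set w | (delta <= spectral_gap (reconnected_arcs A (fun i => X i w)))%R])%E.
Proof.
move=> geoX indX k1 symA dsA irrA gapA De0 de0 D0 N0 /andP[s0 s16] /andP[p0 p1] Dp.
move=> n1 n2 n3 n4 n5.
pose grid := ((bool * 'I_N.+1) * (bool * 'I_N.+1))%type.
pose far (g : grid) : bool := 16 * s / D%:R <= cmod (1 - grid_point (R := R) g).
(* [None] controls the total length; no escape is available for the grid points
     near 1, where the full set makes the requirement void *)
pose F (o : option grid) : set nat := match o with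
  | None => [set n | (D < n)%N]
  | Some g => [set n | far g -> 2 * s <= cmod (1 - grid_point (R := R) g ^+ n)]
  end.
have pow_ge n : (n <= D)%N -> 2^-1 <= (1 - p) ^+ n.
  move=> nD; apply: le_trans (exprn_ge_bernoulli _ _); last by lra.
  have : n%:R * p <= D%:R * p by rewrite ler_wpM2r // ler_nat.
  lra.
have hF i o : (3^-1%:E <= P (X i @^-1` F o))%E.
  case: o => [g|] /=; last first.
    by rewrite (geometric_tail (geoX i)) lee_fin; have := pow_ge D (leqnn D); lra.
  case fg : (far g); last first.
    rewrite (_ : [set n | _] = setT); last by apply/seteqP.
    by rewrite preimage_setT probability_setT lee_fin; lra.
  have [e /andP[e0 eD] he] := far_from_one_power D0 s16 fg.
  rewrite (_ : [set n | _] = ~` [set n | cmod (1 - grid_point (R := R) g ^+ n) < 2 * s]).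
    apply: (geometric_escape (geoX i) (pow_ge e eD)) => m /= hm.
    apply/negP; rewrite -leNgt; apply: far_power_shift he hm; lra.
  apply/seteqP; split => n /= h; first by apply/negP; rewrite -leNgt; exact: h.
  by move=> _; rewrite leNgt; exact/negP.
have := @good_lengths_prob _ _ _ P k p X geoX indX _ F 3^-1 b M _ hF.
have -> : #|{: option grid}| = (4 * N.+1 ^ 2 + 1)%N.
  rewrite card_option !card_prod card_bool card_ord addn1; congr S.
  by rewrite expnS expn1 mulnACA.
set bad := [set w | ~ _] => hbad.
have mbad : measurable bad.
  exact: (measurable_of_lengths X (fun l => ~ ((forall i, (0 < l i <= M)%N) /\
               forall o, blocks_hit b l (F o)))).
apply: (@le_trans _ _ (P (~` bad))); last first.
  apply: le_measure; rewrite ?inE; first exact: measurableC.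
    exact: (measurable_of_lengths X
      (fun l => delta <= spectral_gap (reconnected_arcs A l))).
  move=> w /= /contrapT[hM hh].
  apply: (@spectral_gap_reconnected_arcs_ge _ _ A _ Delta delta s M D N b) => //.
    exact: hh None.
  by move=> g fg t tk; have [i it Fi] := hh (Some g) t tk; exists i => //; exact: Fi.
rewrite probability_setC // EFinB leeB //.
apply: le_trans (hbad _) _; first by lra.
rewrite lee_fin natrD natrM natrX (_ : 1 - 3^-1 = 2 / 3 :> R) //.
lra.
Qed.

End GapProbability.

(** * Choice of the scales *)

Section Scales.
Context {R : realType}.
Implicit Types (kap H G L V W c B m D N t b K s Delta delta : R).

(** Here kap = log k, V = kap^alpha and W = kap^gamma; m, D, N, b and t are the
    maximal length, the escape scale, the inverse mesh of the grid, the size and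
    the number of blocks.  All the conditions follow from the last and strictest one, of the
    form C kap^5 V < c W, which W >= kap^7 V ensures for large kap.  The
    numerical constant H stays a variable, to keep numerals out of the arithmetic. *)
Lemma scale_conditions kap H L V W c B m D N t b K s Delta delta :
  400 <= H -> 1 <= kap -> 4 <= L -> 0 < V -> V * kap ^+ 7 <= W -> 1 <= B -> 0 < c ->
  100 * H ^+ 2 * B ^+ 2 < c * kap ^+ 2 ->
  s = (H * kap)^-1 -> Delta = c / V -> delta = (L * W)^-1 ->
  0 <= m <= 3 * (L * kap) -> L / 4 <= D -> 6 * H * (L * kap ^+ 2) <= N ->
  b <= B * kap -> 0 < t -> 0 < K -> K <= 2 * b * t ->
  [/\ m * (2 / N) <= s, m * (16 * s / D + 2 / N) <= 2^-1,
      4 * (m * delta) <= Delta,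
      16 * (m * delta) * K < Delta * s ^+ 2 * t &
      16 * m ^+ 3 * delta * K ^+ 2 < Delta * (t * D) ^+ 2].
Proof.
move=> H4 k1 L4 V0 VW B1 c0 big sE DeE deE /andP[m0 m3] D4 N24 bB t0 K0 Kb.
have k0 : 0 < kap by apply: lt_le_trans k1.
have H0 : 0 < H by apply: (lt_le_trans _ H4); rewrite ltr0n.
have Hk0 : 0 < H * kap by exact: mulr_gt0.
have L0 : 0 < L by apply: lt_le_trans L4.
have D0 : 0 < D by apply: lt_le_trans D4; rewrite divr_gt0.
have Lk0 : 0 < L * kap ^+ 2 by rewrite mulr_gt0 ?exprn_gt0.
have N0 : 0 < N by apply: lt_le_trans N24; rewrite !mulr_gt0.
have s0 : 0 < s by rewrite sE invr_gt0.
have ks : H * kap * s = 1 by rewrite sE mulfV // gt_eqF.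
have W0 : 0 < W by apply: lt_le_trans VW; rewrite mulr_gt0 ?exprn_gt0.
have DV : Delta * V = c by rewrite DeE divfK ?gt_eqF.
have dLW : delta * L * W = 1.
  by rewrite deE -mulrA mulVf // mulf_neq0 ?gt_eqF.
have De0 : 0 < Delta by rewrite DeE divr_gt0.
have de0 : 0 < delta by rewrite deE invr_gt0 mulr_gt0.
have key : 100 * H ^+ 2 * B ^+ 2 * kap ^+ 5 * V < c * W.
  apply: lt_le_trans (ler_wpM2l (ltW c0) VW).
  have e : c * (V * kap ^+ 7) = (c * kap ^+ 2) * (kap ^+ 5 * V).
    by rewrite !exprS expr0; ring.
  by rewrite e -mulrA ltr_pM2r // mulr_gt0 ?exprn_gt0.
have kpow n : 1 <= kap ^+ n by exact: exprn_ege1.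
have c1 : m * (2 / N) <= s.
  rewrite mulrA ler_pdivrMr //.
  have : s * (6 * H * (L * kap ^+ 2)) <= s * N by rewrite ler_wpM2l // ltW.
  have -> : s * (6 * H * (L * kap ^+ 2)) = 6 * (L * kap) * (H * kap * s).
    by rewrite expr2; ring.
  by rewrite ks; move: m3; clear; lra.
have mdW : m * delta * W <= 3 * kap.
  rewrite -(ler_pM2r L0).
  have -> : m * delta * W * L = m * (delta * L * W) by ring.
  by rewrite dLW; move: m3; clear; lra.
have K2 : K <= 2 * B * kap * t.
  apply: le_trans Kb _; by rewrite ler_pM2r //; move: bB; clear; lra.
have WV0 : 0 < W * V by rewrite mulr_gt0.
have B0 : 0 < B by apply: lt_le_trans B1.
have B2 : B <= B ^+ 2 by rewrite expr2 ler_peMl // ltW.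
have B21 : 1 <= B ^+ 2 by exact: le_trans B2.
have H2 : 400 <= H ^+ 2.
  by apply: (le_trans H4); rewrite expr2 ler_peMl ?(ltW H0) // (le_trans _ H4) // ler1n.
have HB2 : 400 * B ^+ 2 <= H ^+ 2 * B ^+ 2 by rewrite ler_wpM2r ?exprn_ge0 // ltW.
have HB1 : H ^+ 2 * B <= H ^+ 2 * B ^+ 2 by rewrite ler_wpM2l ?exprn_ge0 // ltW.
have weak (x : R) n : 0 <= x <= 100 * H ^+ 2 * B ^+ 2 -> (n <= 5)%N ->
    x * kap ^+ n * V < c * W.
  move=> /andP[x0 xB] n5; apply: le_lt_trans key; rewrite ler_pM2r //.
  by apply: ler_pM => //; [rewrite exprn_ge0 // ltW | rewrite ler_weXn2l].
split => //.
- rewrite mulrDr.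
  have h : 16 * s / D <= 64 * s / L.
    rewrite ler_pdivrMr // mulrAC ler_pdivlMr //.
    by have := ler_wpM2l (ltW s0) D4; clear; lra.
  have h2 : m * (16 * s / D) <= 3 * (L * kap) * (64 * s / L).
    by apply: ler_pM => //; apply: divr_ge0; rewrite ?mulr_ge0 ?ltW.
  have e : 3 * (L * kap) * (64 * s / L) = 192 / H * (H * kap * s).
    by field; rewrite !gt_eqF.
  rewrite e ks in h2.
  have sH : s <= H^-1 by rewrite sE lef_pV2 ?posrE // ler_peMr // ltW.
  have HV : H^-1 <= 400^-1 by rewrite lef_pV2 ?posrE ?ltr0n.
  by move: c1 h2 sH HV; clear; lra.
- rewrite -(ler_pM2r WV0).
  have -> : 4 * (m * delta) * (W * V) = 4 * (m * delta * W) * V by ring.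
  have -> : Delta * (W * V) = (Delta * V) * W by ring.
  rewrite DV; apply: le_trans (ltW (@weak 12 1%N _ _)) => //.
    by rewrite expr1 ler_pM2r //; move: mdW; clear; lra.
  rewrite ler0n /=; move: HB2 B21; clear; lra.
- rewrite -(ltr_pM2r WV0) -(@ltr_pM2r _ (H ^+ 2 * kap ^+ 2)); last first.
    by rewrite mulr_gt0 ?exprn_gt0.
  have -> : Delta * s ^+ 2 * t * (W * V) * (H ^+ 2 * kap ^+ 2) =
      (Delta * V) * W * t * (H * kap * s) ^+ 2 by ring.
  rewrite DV ks expr1n mulr1.
  have -> : 16 * (m * delta) * K * (W * V) * (H ^+ 2 * kap ^+ 2) =
      (16 * H ^+ 2 * kap ^+ 2 * V) * ((m * delta * W) * K) by ring.
  apply: (@le_lt_trans _ _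
    ((16 * H ^+ 2 * kap ^+ 2 * V) * ((3 * kap) * (2 * B * kap * t)))).
    rewrite ler_pM2l ?mulr_gt0 ?exprn_gt0 //; apply: ler_pM => //; last exact: ltW.
    by rewrite !mulr_ge0 // ltW.
  have -> : 16 * H ^+ 2 * kap ^+ 2 * V * (3 * kap * (2 * B * kap * t)) =
    (96 * H ^+ 2 * B) * kap ^+ 4 * V * t by ring.
  rewrite ltr_pM2r //; apply: weak => //.
  rewrite mulr_ge0 ?(ltW B0) ?mulr_ge0 ?exprn_ge0 ?(ltW H0) //=.
  move: HB1 HB2 B21; clear; lra.
have WVL0 : 0 < W * V * L by rewrite mulr_gt0.
rewrite -(ltr_pM2r WVL0).
have -> : 16 * m ^+ 3 * delta * K ^+ 2 * (W * V * L) =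
  16 * V * (m ^+ 3 * K ^+ 2) * (delta * L * W) by ring.
have -> : Delta * (t * D) ^+ 2 * (W * V * L) =
  (Delta * V) * W * L * t ^+ 2 * D ^+ 2 by ring.
rewrite DV dLW mulr1.
apply: (@le_lt_trans _ _ (16 * V * ((3 * (L * kap)) ^+ 3 * (2 * B * kap * t) ^+ 2))).
  rewrite ler_pM2l ?mulr_gt0 //; apply: ler_pM; rewrite ?exprn_ge0 //; first exact: ltW.
    by rewrite lerXn2r // nnegrE // (le_trans m0).
  by rewrite lerXn2r // nnegrE ltW // (lt_le_trans K0).
apply: (@lt_le_trans _ _ (c * W * L * t ^+ 2 * (L / 4) ^+ 2)); last first.
  rewrite ler_pM2l ?mulr_gt0 ?exprn_gt0 //.
  by rewrite lerXn2r // nnegrE ltW // divr_gt0.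
have -> : 16 * V * ((3 * (L * kap)) ^+ 3 * (2 * B * kap * t) ^+ 2) =
  (27 * 1024 * B ^+ 2 * kap ^+ 5 * V) * (L ^+ 3 * t ^+ 2 / 16) by field.
have -> : c * W * L * t ^+ 2 * (L / 4) ^+ 2 = (c * W) * (L ^+ 3 * t ^+ 2 / 16) by field.
rewrite ltr_pM2r ?divr_gt0 ?mulr_gt0 ?exprn_gt0 //; apply: weak => //.
by move: HB2 B21; clear; lra.
Qed.

Lemma expr_1sub_le_expR (x : R) n : x <= 1 -> (1 - x) ^+ n <= expR (- (x * n%:R)).
Proof.
move=> x1; rewrite -mulNr mulrC expRM_natl.
by rewrite lerXn2r ?nnegrE ?expR_ge0 ?subr_ge0 // expR_ge1Dx.
Qed.

(** In powers of k = exp(kap), up to constants: a length exceeds M with probability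
    k^(-2), the grid has at most k^(2 rho + 4) points, and a block misses a given
    set with probability k^(-(2 rho + 6)). *)
Lemma failure_bound kap H G L rho (k M N b : nat) :
  0 <= H -> 6 * H + 2 <= G -> 1 <= kap -> 4 <= L ->
  k%:R = expR kap -> L <= expR (rho * kap) ->
  2 * (L * kap) <= M%:R -> N%:R <= 6 * H * (L * kap ^+ 2) + 1 ->
  3 * (2 * rho + 6) * kap <= b%:R ->
  k%:R * (1 - L^-1) ^+ M + (4 * N.+1%:R ^+ 2 + 1) * (k%:R * (2 / 3) ^+ b)
    <= (1 + 5 * G ^+ 2) / k%:R.
Proof.
move=> H0 HG k1 L4 kE Lrho M2 NL bb.
have L0 : 0 < L by lra.
rewrite kE -expRN [leRHS]mulrDl [X in _ <= X + _]mul1r; apply: lerD.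
  have h : (1 - L^-1) ^+ M <= expR (- (2 * kap)).
    apply: le_trans (expr_1sub_le_expR _ _) _; first by rewrite invf_le1 //; lra.
    by rewrite ler_expR lerN2 [L^-1 * _]mulrC ler_pdivlMr //; lra.
  apply: le_trans (ler_wpM2l (expR_ge0 _) h) _.
  by rewrite -expRD ler_expR; lra.
have h : (2 / 3) ^+ b <= expR (- ((2 * rho + 6) * kap)).
  have -> : 2 / 3 = 1 - 3^-1 :> R by field.
  apply: le_trans (expr_1sub_le_expR _ _) _; first by lra.
  by rewrite ler_expR; lra.
have Lk : L * kap ^+ 2 <= expR ((rho + 2) * kap).
  have -> : (rho + 2) * kap = rho * kap + 2%:R * kap by ring.
  rewrite expRD expRM_natl; apply: ler_pM => //.
  - exact: ltW.
  - by rewrite exprn_ge0 //; lra.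
  - rewrite lerXn2r ?nnegrE ?expR_ge0 //; first lra.
    by apply: le_trans (expR_ge1Dx _); lra.
have Lk1 : 1 <= L * kap ^+ 2.
  by have := exprn_ege1 2 k1; nra.
have hN : N.+1%:R <= G * (L * kap ^+ 2).
  by rewrite -natr1; have := ler_wpM2r (le_trans ler01 Lk1) HG; lra.
have G0 : 0 <= G by lra.
set E := expR ((rho + 2) * kap) in Lk.
have hN2 : 4 * N.+1%:R ^+ 2 + 1 <= 5 * G ^+ 2 * E ^+ 2.
  have hNE : N.+1%:R <= G * E by apply: le_trans hN _; exact: ler_wpM2l.
  have : N.+1%:R ^+ 2 <= (G * E) ^+ 2 :> R.
    by rewrite lerXn2r ?nnegrE // mulr_ge0 ?expR_ge0.
  have : 1 <= N.+1%:R ^+ 2 :> R by rewrite exprn_ege1 // ler1n.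
  rewrite exprMn; lra.
apply: le_trans (ler_pM _ _ hN2 (ler_wpM2l (expR_ge0 kap) h)) _.
- by rewrite addr_ge0 // mulr_ge0 // sqr_ge0.
- by rewrite mulr_ge0 ?expR_ge0 // exprn_ge0 // divr_ge0.
rewrite -(mulrA (5 * G ^+ 2)); apply: ler_wpM2l; first by rewrite mulr_ge0 ?sqr_ge0.
rewrite /E -expRM_natl -!expRD ler_expR; lra.
Qed.

End Scales.

(** * The asymptotic statement *)

Section HighProbability.
Context {R : realType}.

(** The maximal length 2 L log k, the escape scale L / 2, the mesh 1 / (L log^2 k)
    and the block size B log k, B being dictated by [failure_bound]. *)
Lemma spectral_gap_high_probability (rho c alpha gamma : R) :
  0 < rho -> 0 < c -> 7 + alpha < gamma ->
  exists K0 C0 : R, forall (d : measure_display) (T : measurableType d)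
    (P : probability T R) (k : nat) (L : R) (A : 'M[R]_k) (X : 'I_k -> {RV P >-> nat}),
  K0 <= ln k%:R -> 4 <= L -> ln L <= rho * ln k%:R -> gap_class c alpha A ->
  (forall i, geometric_rv L^-1 (X i)) -> independent_rvs X ->
  ((1 - C0 / k%:R)%:E <= P [set w |
    ((L * ln k%:R `^ gamma)^-1 <=
     spectral_gap (reconnected_arcs A (fun i => X i w)))%R])%E.
Proof.
move=> rho0 c0 hgamma.
(* opaque names for numerical constants that arithmetic should not unfold *)
have [H H4] : exists H : R, 400 <= H by exists 400.
have [G HG] : exists G : R, 6 * H + 2 <= G by exists (6 * H + 2).
have [B BE] : exists B : R, B = 3 * (2 * rho + 6) + 1 by eexists.
have B1 : 1 <= B by rewrite BE; lra.
exists (1 + 2 * B + 100 * H ^+ 2 * B ^+ 2 / c), (1 + 5 * G ^+ 2).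
move=> d T P k L A X; set kap := ln k%:R => hk L4 hL [symA dsA irrA gapA] geoX indX.
have L0 : 0 < L by lra.
have big0 : 0 <= 100 * H ^+ 2 * B ^+ 2 / c.
  by rewrite divr_ge0 ?(ltW c0) // mulr_ge0 ?sqr_ge0 // mulr_ge0 ?sqr_ge0.
have H0 : 0 < H by apply: (lt_le_trans _ H4); rewrite ltr0n.
have kap1 : 1 <= kap by lra.
have kap0 : 0 < kap by lra.
have k0 : (0 < k)%N.
  rewrite lt0n; apply/eqP => k00; move: kap0.
  by rewrite /kap k00 ln0 ?ltxx.
have kE : k%:R = expR kap by rewrite lnK // posrE ltr0n.
have kge : 1 + kap ^+ 2 / 2 <= k%:R by rewrite kE; have := expR_ge1Dxn 1 (ltW kap0).
have kB : B * kap <= k%:R.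
  have : 2 * B * kap <= kap * kap by rewrite ler_pM2r //; lra.
  rewrite expr2 in kge; lra.
have Lk0 : 4 <= L * kap by nra.
have Lk2 : 0 <= 6 * H * (L * kap ^+ 2) by rewrite !mulr_ge0 ?exprn_ge0 // ltW.
have LhE : 0 <= L / 2 by lra.
have L2kap : 0 <= 2 * (L * kap) by lra.
have Bkap0 : 0 <= (B - 1) * kap by rewrite mulr_ge0 ?subr_ge0 // ltW.
have floor (x : R) : 0 <= x -> exists n : nat, n%:R <= x /\ x < n.+1%:R.
  by move=> /truncn_itv/andP[h1 h2]; exists (Num.truncn x).
have [M0 [M1 M2]] := floor _ L2kap.
have [D [D1 D2]] := floor _ LhE.
have [N0 [N1 N2]] := floor _ Lk2.
have [b0 [b1 b2]] := floor _ Bkap0.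
have bB : b0.+1%:R <= B * kap by rewrite -natr1; lra.
have bk : (b0.+1 <= k)%N by rewrite -(ler_nat R) (le_trans bB).
have t0 : (0 < k %/ b0.+1)%N by rewrite divn_gt0.
have kt : k%:R <= 2 * b0.+1%:R * (k %/ b0.+1)%:R :> R.
  rewrite -!natrM ler_nat {1}(divn_eq k b0.+1) mulnAC -mulnA mul2n -addnn mulnC leq_add2l.
  rewrite (leq_trans (ltnW (ltn_pmod k (ltn0Sn b0)))) //.
  by rewrite mulnC leq_pmull.
have D4 : L / 4 <= D%:R by move: D2; rewrite -[D.+1%:R]natr1; lra.
have D0 : (0 < D)%N by rewrite -(ltr_nat R) (lt_le_trans _ D4) // divr_gt0.
pose V := kap `^ alpha; pose W := kap `^ gamma.
have V0 : 0 < V by exact: powR_gt0.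
have VW : V * kap ^+ 7 <= W.
  rewrite -powR_mulrn ?(ltW kap0) // -powRD; last by rewrite (gt_eqF kap0) implybT.
  by apply: ler_powR => //; lra.
have bigk : 100 * H ^+ 2 * B ^+ 2 < c * kap ^+ 2.
  have h : 100 * H ^+ 2 * B ^+ 2 / c < kap by lra.
  rewrite ltr_pdivrMr // in h; apply: lt_le_trans h _.
  by rewrite mulrC expr2 mulrA ler_peMr // mulr_ge0 // ltW.
have MM : 0 <= (M0.+1%:R : R) <= 3 * (L * kap).
  by apply/andP; split; [exact: ler0n | rewrite -[M0.+1%:R]natr1; lra].
have t0' : 0 < (k %/ b0.+1)%:R :> R by rewrite ltr0n.
have k0' : 0 < k%:R :> R by rewrite ltr0n.
have [n1 n2 n3 n4 n5] := scale_conditions H4 kap1 L4 V0 VW B1 c0 bigk erefl erefl erefl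
  MM D4 (ltW N2) bB t0' k0' kt.
have k1 : (1 < k)%N.
  rewrite -(ltr_nat R); apply: lt_le_trans kge; rewrite ltrDl.
  by rewrite divr_gt0 ?exprn_gt0.
have W0 : 0 < W by exact: powR_gt0.
have Hk16 : 16 <= H * kap.
  apply: (@le_trans _ _ 400); first by rewrite ler_nat.
  by apply: (le_trans H4); rewrite ler_peMr // ltW.
have Hk0 : 0 < H * kap by apply: mulr_gt0.
have s16 : 0 < (H * kap)^-1 <= 16^-1.
  by rewrite invr_gt0 Hk0 lef_pV2 ?posrE ?ltr0n.
have p01 : 0 <= L^-1 <= 1.
  by rewrite invr_ge0 (ltW L0) invf_le1 // (le_trans _ L4) // ler1n.
have Dp : D%:R * L^-1 <= 2^-1 by rewrite ler_pdivrMr //; lra.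
have := @spectral_gap_probability d T R P k L^-1 X A (c / V) (L * W)^-1
  (H * kap)^-1 M0.+1 D N0.+1 b0.+1 geoX indX k1 symA dsA irrA _ _ _ D0 isT s16 p01
  Dp n1 n2 n3 n4 n5.
move=> main; apply: le_trans (main _ _ _).
- rewrite lee_fin lerB //; apply: (@failure_bound _ kap H G L rho) => //.
  + exact: ltW.
  + by rewrite -ler_ln ?posrE ?expR_gt0 // expRK.
  + exact: ltW.
  + by rewrite -[N0.+1%:R]natr1 lerD2r.
  + by apply: ltW; move: b2; rewrite BE addrK.
- by apply: le_trans gapA; rewrite powRN.
- by rewrite divr_gt0.
- by rewrite invr_gt0 mulr_gt0.
Qed.

End HighProbability.

Theorem theorem5 (R : realType) (rho_l rho_u c alpha gamma : R)
  (rho_l_gt0 : 0 < rho_l) (rho_lu : rho_l < rho_u)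
  (c_gt0 : 0 < c) (alpha_ge0 : 0 <= alpha) (gamma_gt : 7 + alpha < gamma)
  (k : nat -> nat) (L : nat -> R)
  (k_cvg : k n @[n --> \oo] --> \oo)
  (L_cvg : L n @[n --> \oo] --> +oo)
  (L_ge1 : forall n, 1 <= L n)
  (kL : forall n, rho_l < ln (L n) / ln (k n)%:R < rho_u)
  (A : forall m : nat, 'M[R]_m)
  (A_class : forall n, gap_class c alpha (A (k n)))
  (d : nat -> measure_display) (T : forall n, measurableType (d n))
  (P : forall n, probability (T n) R)
  (len : forall n, 'I_(k n) -> {RV (P n) >-> nat})
  (len_geom : forall n i, geometric_rv (L n)^-1 (len n i))
  (len_indep : forall n, independent_rvs (len n)) :
  P n [set w | (L n * ln (k n)%:R `^ gamma)^-1
               <= spectral_gap (reconnected_arcs (A (k n)) (fun i => len n i w))]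
    @[n --> \oo] --> 1%E.
Proof.
have rho_u_gt0 : 0 < rho_u by lra.
have [K0 [C0 main]] := spectral_gap_high_probability rho_u_gt0 c_gt0 gamma_gt.
apply: (@squeeze_cvge _ _ _ _ (fun n => (1 - C0 / (k n)%:R)%:E) _ (fun=> 1%E)).
- near=> n; apply/andP; split; last first.
    apply: probability_le1.
    exact: (measurable_of_lengths (len n) (fun l => (L n * ln (k n)%:R `^ gamma)^-1
      <= spectral_gap (reconnected_arcs (A (k n)) l))).
  have kn : (Num.truncn (expR (Num.max K0 1))).+1%:R <= (k n)%:R :> R.
    by rewrite ler_nat; near: n; move/cvgnyPge: k_cvg; apply.
  have kK : Num.max K0 1 <= ln (k n)%:R.
    rewrite -ler_expR lnK; last by rewrite posrE; apply: lt_le_trans kn.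
    by apply: le_trans kn; rewrite ltW // truncnS_gt.
  have ln_ge1 : 1 <= ln (k n)%:R :> R by apply: le_trans kK; rewrite le_max lexx orbT.
  apply: main => //.
  - by apply: le_trans kK; rewrite le_max lexx.
  - by near: n; move/cvgryPge: L_cvg; apply.
  - have /andP[_ /ltW] := kL n; rewrite ler_pdivrMr //; lra.
- apply: cvg_EFin; first by near=> n.
  rewrite -[X in _ --> X]subr0; apply: cvgB; first exact: cvg_cst.
  rewrite -[X in _ --> X](mulr0 C0); apply: cvgM; first exact: cvg_cst.
  apply/gtr0_cvgV0.
    near=> n; rewrite ltr0n; near: n; move/cvgnyPge: k_cvg; apply.
  exact/cvgrnyP.
- exact: cvg_cst.
Unshelve. all: by end_near.
Qed.
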